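(* Let $\mathcal{M}=(\mathbb{R}^+\times\mathbb{R},\nabla)$ be a Type $\mathcal{B}$ surface model with $\dim\{\mathfrak{K}(\mathcal{M})\}=4$. Then one of the following holds, where the solution spaces are those of the indicated model and $\rho=(x^1)^{-2}\tilde\rho_{11}\,dx^1\otimes dx^1$ with $\tilde\rho_{11}\ne 0$: (1) $\mathcal{M}$ is linearly isomorphic to $\mathcal{Z}_1^\kappa$ for some $\kappa\in\mathbb{R}$ (here $\tilde\rho_{11}=\kappa(\kappa+1)$), and $E(-1,\nabla)=(x^1)^\kappa\operatorname{Span}\{1,\ x^1,\ x^2+x^1\log x^1\}$. Moreover, for $\mu\in\mathbb{R}$ with $\mu\neq -1$: (a) if $\frac14+\tilde\rho_{11}(1+\mu)\neq 0$, then $E(\mu,\nabla)=\operatorname{Span}\{(x^1)^{\alpha_+},(x^1)^{\alpha_-}\}$, where $\alpha_\pm=\frac12+\kappa\pm\sqrt{\frac14+\tilde\rho_{11}(1+\mu)}$; (b) if $\frac14+\tilde\rho_{11}(1+\mu)=0$, then $\mu=-\frac14(1+4\tilde\rho_{11})\tilde\rho_{11}^{-1}$ and $E(\mu,\nabla)=(x^1)^{\kappa+\frac12}\operatorname{Span}\{1,\log x^1\}$. (2) $\mathcal{M}$ is linearly isomorphic to $\mathcal{Z}_2^{\kappa,\theta}$ for some $\kappa,\theta\in\mathbb{R}$ with $\theta\ne0$ (here $\tilde\rho_{11}=\kappa(\kappa+\theta)$), and $E(-1,\nabla)=(x^1)^\kappa\operatorname{Span}\{1,\ x^2,\ (x^1)^\theta\}$.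 Moreover, for $\mu\in\mathbb{R}$ with $\mu\neq-1$: (a) if $(2\kappa+\theta)^2+4\mu\tilde\rho_{11}\neq 0$, then $E(\mu,\nabla)=\operatorname{Span}\{(x^1)^{\alpha_+},(x^1)^{\alpha_-}\}$, where $\alpha_\pm=\frac12\left(2\kappa+\theta\pm\sqrt{(2\kappa+\theta)^2+4\mu\tilde\rho_{11}}\right)$; (b) if $(2\kappa+\theta)^2+4\mu\tilde\rho_{11}=0$, then $\mu=-\frac14(2\kappa+\theta)^2\tilde\rho_{11}^{-1}$ and $E(\mu,\nabla)=(x^1)^{\kappa+\frac12\theta}\operatorname{Span}\{1,\log x^1\}$. (3) $\mathcal{M}$ is linearly isomorphic to $\mathcal{Z}_3^\kappa$ for some $\kappa\in\mathbb{R}$ (here $\tilde\rho_{11}=\kappa^2$), and $E(-1,\nabla)=(x^1)^\kappa\operatorname{Span}\{1,\ x^2,\ \log x^1\}$. Moreover, for $\mu\in\mathbb{R}$ with $\mu\neq-1$, $E(\mu,\nabla)=\operatorname{Span}\{(x^1)^{\alpha_+},(x^1)^{\alpha_-}\}$, where $\alpha_\pm=\kappa\pm\sqrt{\tilde\rho_{11}(1+\mu)}$. When exponents are non-real complex numbers, the equalities are understood for the complexification $E(\mu,\nabla)\otimes_{\mathbb{R}}\mathbb{C}$ with complex spans.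
   Context: For a torsion free connection $\nabla$ on a surface, with $\nabla_{\partial_{x^i}}\partial_{x^j}=\Gamma_{ij}{}^k\partial_{x^k}$, put $R(X,Y)=[\nabla_X,\nabla_Y]-\nabla_{[X,Y]}$, $\rho(X,Y)=\operatorname{Tr}\{Z\mapsto R(Z,X)Y\}$, and let $\rho_s$ be the symmetrization of $\rho$. The Hessian is $\mathcal{H}f=(\partial_{x^i}\partial_{x^j}f-\Gamma_{ij}{}^k\partial_{x^k}f)\,dx^i\otimes dx^j$, and for $\mu\in\mathbb{R}$, $E(\mu,\nabla)=\{f\in C^\infty: \mathcal{H}f=\mu f\rho_s\}$. $\mathfrak{K}(\mathcal{M})$ is the Lie algebra of affine Killing vector fields, i.e. vector fields $X$ with $\mathcal{L}_X\nabla=0$. A Type $\mathcal{B}$ surface model is $\mathbb{R}^+\times\mathbb{R}$ (coordinates $x^1>0$, $x^2$) with Christoffel symbols $\Gamma_{ij}{}^k=(x^1)^{-1}C_{ij}{}^k$, $C_{ij}{}^k=C_{ji}{}^k$ real constants. Two such models are linearly isomorphic if some map $(x^1,x^2)\mapsto(x^1,a\,x^1+b\,x^2)$ with $b\neq0$ intertwines the connections. Models (unlisted $C_{ij}{}^k$, apart from symmetry, are zero): $\mathcal{Z}_1^\kappa$: $C_{11}{}^1=2\kappa$, $C_{11}{}^2=1$, $C_{12}{}^2=\kappa$. $\mathcal{Z}_2^{\kappa,\theta}$: $C_{11}{}^1=2\kappa+\theta-1$, $C_{12}{}^2=\kappa$. $\mathcal{Z}_3^\kappa$: $C_{11}{}^1=2\kappa-1$,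 $C_{12}{}^2=\kappa$. The notation $g\operatorname{Span}\{h_1,\dots\}$ means $\operatorname{Span}\{gh_1,\dots\}$. *)

(* Defs.v *)
From Stdlib Require Import Reals List.
From Coquelicot Require Import Coquelicot.
Import ListNotations.
Open Scope R_scope.

(** The manifold is the half plane [0 < x1].  Functions on it are total functions
    [R -> R -> R] of which only the values at points with [0 < x1] matter: every
    condition below is restricted to such points, and since the half plane is open,
    the derivatives there do not see the values outside. *)

Inductive idx : Set := i1 | i2.

Definition sum2 (F : idx -> R) : R := F i1 + F i2.

Definition fn := R -> R -> R.
Definition vfield := idx -> fn.
(** [G i j k] is the Christoffel symbol with lower indices [i], [j] and upper index [k]. *)
Definition christoffel := idx -> idx -> idx -> fn.

Definition partial (i : idx) (f : fn) : fn := fun x1 x2 =>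
  match i with
  | i1 => Derive (fun t => f t x2) x1
  | i2 => Derive (fun t => f x1 t) x2
  end.

Definition smooth (f : fn) : Prop :=
  forall n x1 x2, 0 < x1 -> ex_diff_n f n x1 x2.

Definition smooth_vf (X : vfield) : Prop := forall i, smooth (X i).

Definition coord_vf (i : idx) : vfield := fun j _ _ =>
  match i, j with i1, i1 | i2, i2 => 1 | _, _ => 0 end.

Definition bracket (X Y : vfield) : vfield := fun k x1 x2 =>
  sum2 (fun i => X i x1 x2 * partial i (Y k) x1 x2
               - Y i x1 x2 * partial i (X k) x1 x2).

Definition cov (G : christoffel) (X Y : vfield) : vfield := fun k x1 x2 =>
  sum2 (fun i => X i x1 x2 * partial i (Y k) x1 x2)
  + sum2 (fun i => sum2 (fun j => X i x1 x2 * Y j x1 x2 * G i j k x1 x2)).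

Definition curv (G : christoffel) (X Y Z : vfield) : vfield := fun k x1 x2 =>
  cov G X (cov G Y Z) k x1 x2 - cov G Y (cov G X Z) k x1 x2
  - cov G (bracket X Y) Z k x1 x2.

(** Trace of [Z |-> R(Z, X) Y], computed in the coordinate frame. *)
Definition ricci (G : christoffel) (X Y : vfield) : fn := fun x1 x2 =>
  sum2 (fun k => curv G (coord_vf k) X Y k x1 x2).

Definition ricci_sym (G : christoffel) (X Y : vfield) : fn := fun x1 x2 =>
  (ricci G X Y x1 x2 + ricci G Y X x1 x2) / 2.

(** The Ricci tensor is [(x1)^-2 * r * dx1 (x) dx1]. *)
Definition ricci_is (G : christoffel) (r : R) : Prop :=
  forall x1 x2, 0 < x1 -> forall i j,
    ricci G (coord_vf i) (coord_vf j) x1 x2 =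
    match i, j with i1, i1 => / x1 ^ 2 * r | _, _ => 0 end.

Definition hessian (G : christoffel) (f : fn) (i j : idx) : fn := fun x1 x2 =>
  partial i (partial j f) x1 x2
  - sum2 (fun k => G i j k x1 x2 * partial k f x1 x2).

Definition E (mu : R) (G : christoffel) (f : fn) : Prop :=
  smooth f /\
  forall x1 x2, 0 < x1 -> forall i j,
    hessian G f i j x1 x2 =
    mu * f x1 x2 * ricci_sym G (coord_vf i) (coord_vf j) x1 x2.

(** [(L_X nabla)(Y, Z)]. *)
Definition lie_conn (G : christoffel) (X Y Z : vfield) : vfield := fun k x1 x2 =>
  bracket X (cov G Y Z) k x1 x2 - cov G (bracket X Y) Z k x1 x2
  - cov G Y (bracket X Z) k x1 x2.

Definition affine_killing (G : christoffel) (X : vfield) : Prop :=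
  smooth_vf X /\
  forall Y Z, smooth_vf Y -> smooth_vf Z ->
  forall k x1 x2, 0 < x1 -> lie_conn G X Y Z k x1 x2 = 0.

(** Linear combination; if the lists have different lengths the longer is truncated. *)
Fixpoint lincomb (c : list R) (l : list fn) : fn :=
  match c, l with
  | a :: c', h :: l' => fun x1 x2 => a * h x1 x2 + lincomb c' l' x1 x2
  | _, _ => fun _ _ => 0
  end.

Definition span (l : list fn) (f : fn) : Prop :=
  exists c, length c = length l /\
    forall x1 x2, 0 < x1 -> f x1 x2 = lincomb c l x1 x2.

Definition lincomb_vf (c : list R) (l : list vfield) : vfield := fun i =>
  lincomb c (map (fun X => X i) l).

(** The subspace [V] of vector fields has dimension [n] over the reals. *)
Definition dim_vf (V : vfield -> Prop) (n : nat) : Prop :=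
  exists l : list vfield,
    length l = n /\
    (forall X, In X l -> V X) /\
    (forall c, length c = n ->
       (forall i x1 x2, 0 < x1 -> lincomb_vf c l i x1 x2 = 0) ->
       forall a, In a c -> a = 0) /\
    (forall X, V X -> exists c, length c = n /\
       forall i x1 x2, 0 < x1 -> X i x1 x2 = lincomb_vf c l i x1 x2).

Definition same_space {T : Type} (V W : T -> Prop) : Prop := forall f, V f <-> W f.

(** Complex-valued functions: [V (x) C] is [V + i V]. *)
Definition cfn := R -> R -> C.

Definition complexify (V : fn -> Prop) (f : cfn) : Prop :=
  V (fun x1 x2 => Re (f x1 x2)) /\ V (fun x1 x2 => Im (f x1 x2)).

Fixpoint clincomb (c : list C) (l : list cfn) : cfn :=
  match c, l with
  | a :: c', h :: l' => fun x1 x2 => (a * h x1 x2 + clincomb c' l' x1 x2)%C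
  | _, _ => fun _ _ => RtoC 0
  end.

Definition cspan (l : list cfn) (f : cfn) : Prop :=
  exists c, length c = length l /\
    forall x1 x2, 0 < x1 -> f x1 x2 = clincomb c l x1 x2.

Definition cexp (z : C) : C := (exp (Re z) * cos (Im z), exp (Re z) * sin (Im z)).

(** [x ^ z] for [0 < x]. *)
Definition cpower (x : R) (z : C) : C := cexp (z * RtoC (ln x))%C.

(** A complex square root of a real number. *)
Definition csqrt (d : R) : C :=
  if Rle_dec 0 d then RtoC (sqrt d) else (Ci * RtoC (sqrt (- d)))%C.

(** [V = Span {(x1)^ap, (x1)^am}]: an equality of real spaces when both exponents
    are real, and of complexifications otherwise. *)
Definition spanned_by_powers (V : fn -> Prop) (ap am : C) : Prop :=
  (Im ap = 0 /\ Im am = 0 ->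
     same_space V (span [fun x1 _ => Rpower x1 (Re ap); fun x1 _ => Rpower x1 (Re am)]))
  /\
  (Im ap <> 0 \/ Im am <> 0 ->
     same_space (complexify V)
       (cspan [fun x1 _ => cpower x1 ap; fun x1 _ => cpower x1 am])).

(** [g Span {h1, ...}]. *)
Definition times_span (g : fn) (l : list fn) : fn -> Prop :=
  span (map (fun h x1 x2 => g x1 x2 * h x1 x2) l).

Definition typeB (C : idx -> idx -> idx -> R) : christoffel := fun i j k x1 _ =>
  / x1 * C i j k.

(** Pushforward of [X] by [T (x1, x2) = (x1, a x1 + b x2)], whose inverse is
    [(y1, y2) |-> (y1, (y2 - a y1) / b)]. *)
Definition push (a b : R) (X : vfield) : vfield := fun i y1 y2 =>
  let x2 := (y2 - a * y1) / b in
  match i with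
  | i1 => X i1 y1 x2
  | i2 => a * X i1 y1 x2 + b * X i2 y1 x2
  end.

Definition linearly_isomorphic (G G' : christoffel) : Prop :=
  exists a b : R, b <> 0 /\
  forall X Y, smooth_vf X -> smooth_vf Y ->
  forall k y1 y2, 0 < y1 ->
    push a b (cov G X Y) k y1 y2 = cov G' (push a b X) (push a b Y) k y1 y2.

Definition Z1 (kappa : R) (i j k : idx) : R :=
  match i, j, k with
  | i1, i1, i1 => 2 * kappa
  | i1, i1, i2 => 1
  | i1, i2, i2 | i2, i1, i2 => kappa
  | _, _, _ => 0
  end.

Definition Z2 (kappa theta : R) (i j k : idx) : R :=
  match i, j, k with
  | i1, i1, i1 => 2 * kappa + theta - 1
  | i1, i2, i2 | i2, i1, i2 => kappa
  | _, _, _ => 0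
  end.

Definition Z3 (kappa : R) (i j k : idx) : R :=
  match i, j, k with
  | i1, i1, i1 => 2 * kappa - 1
  | i1, i2, i2 | i2, i1, i2 => kappa
  | _, _, _ => 0
  end.

(* Main.v *)
Require Import Defs.
From Stdlib Require Import Reals List Lra Lia FunctionalExtensionality.
From Coquelicot Require Import Coquelicot.
Import ListNotations.
Open Scope R_scope.

(** Four facts carry the classification.  A Killing field is determined by its 1-jet at one
    point ([killing_unique]), because the Killing equations express its second derivatives
    through its 1-jet.  Evaluation at a point has rank at most two, so a Killing algebra of
    dimension four contains at least two independent fields that vanish at [(1, 0)]; their
    linear parts annihilate the Ricci tensor [rho] and [nabla rho] ([killing_isotropy]).  A
    nonflat connection therefore has at most three independent Killing fields unless
    [C_12^1 = C_22^1 = C_22^2 = 0] ([isotropy_small], a case distinction by the rank of the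
    symmetric part of [rho]).  A flat connection, on the other hand, has global affine
    coordinates on the half plane, which are found explicitly, and then at least five
    independent Killing fields ([flat_dim], [affine_coordinates_dim]).

    What remains is [C_11^1 = p], [C_11^2 = q], [C_12^2 = kappa], with
    [rho = x1^-2 kappa (p - kappa + 1) dx1 (x) dx1] nonzero.  The map
    [(x1, a x1 + b x2)] keeps [p] and [kappa] and replaces [q] by
    [b q + a (p - 2 kappa)].  If [p <> 2 kappa], a shear removes [q], which leaves the second
    or third model with [theta = p - 2 kappa + 1]; if [p = 2 kappa], then [q] is either zero,
    which is the second model with [theta = 1], or can be scaled to one, which is the first
    model.

    For these connections the equation [Hess f = mu f rho] forces
    [f = A(x1) + b x2 x1^kappa], and its part linear in [x2] says that [b = 0] or
    [mu = -1], as [rho] does not vanish ([E_shape]).  The function [A] solves Euler's equation, inhomogeneous when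
    [b q] is nonzero; two homogeneous solutions with nonvanishing Wronskian span all of them
    ([ode2_basis]).  The indicial roots are the exponents of the statement; a double root
    yields the logarithm and a pair of conjugate roots a complex span. *)

(** * Smooth functions on the half plane *)

Lemma half_plane_open (P : R -> R -> Prop) x1 x2 :
  0 < x1 -> (forall u v, 0 < u -> P u v) -> locally_2d P x1 x2.
Proof.
  intros h H. exists (mkposreal x1 h). simpl. intros u v Hu _. apply H.
  apply Rabs_def2 in Hu. lra.
Qed.

Definition is_partial (i : idx) (f : fn) (x1 x2 d : R) : Prop :=
  match i with
  | i1 => is_derive (fun t => f t x2) x1 d
  | i2 => is_derive (fun t => f x1 t) x2 d
  end.

Lemma is_partial_unique i f x1 x2 d :
  is_partial i f x1 x2 d -> partial i f x1 x2 = d.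
Proof. destruct i; apply is_derive_unique. Qed.

Lemma is_partial_ext i f g x1 x2 d : 0 < x1 ->
  (forall u v, 0 < u -> f u v = g u v) ->
  is_partial i f x1 x2 d -> is_partial i g x1 x2 d.
Proof.
  intros h H. destruct i; simpl; intros D.
  - refine (is_derive_ext_loc _ _ _ _ _ D).
    apply (locally_2d_1d_const_y (fun u v => f u v = g u v)).
    now apply half_plane_open.
  - refine (is_derive_ext _ _ _ _ _ D). intros t; now apply H.
Qed.

Lemma partial_ext i f g x1 x2 : 0 < x1 ->
  (forall u v, 0 < u -> f u v = g u v) ->
  partial i f x1 x2 = partial i g x1 x2.
Proof.
  intros h H. destruct i; simpl.
  - apply Derive_ext_loc.
    apply (locally_2d_1d_const_y (fun u v => f u v = g u v)).
    now apply half_plane_open.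
  - apply Derive_ext. intros t; now apply H.
Qed.

Lemma is_partial_const i c x1 x2 : is_partial i (fun _ _ => c) x1 x2 0.
Proof. destruct i; exact (is_derive_const c _). Qed.

Lemma is_partial_plus i f g x1 x2 a b :
  is_partial i f x1 x2 a -> is_partial i g x1 x2 b ->
  is_partial i (fun u v => f u v + g u v) x1 x2 (a + b).
Proof. destruct i; simpl; intros; now apply (@is_derive_plus R_AbsRing R_NormedModule). Qed.

Lemma is_partial_opp i f x1 x2 a :
  is_partial i f x1 x2 a -> is_partial i (fun u v => - f u v) x1 x2 (- a).
Proof. destruct i; simpl; intros; now apply (@is_derive_opp R_AbsRing R_NormedModule). Qed.

Lemma is_partial_minus i f g x1 x2 a b :
  is_partial i f x1 x2 a -> is_partial i g x1 x2 b ->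
  is_partial i (fun u v => f u v - g u v) x1 x2 (a - b).
Proof. destruct i; simpl; intros; now apply (@is_derive_minus R_AbsRing R_NormedModule). Qed.

Lemma is_partial_mult i f g x1 x2 a b :
  is_partial i f x1 x2 a -> is_partial i g x1 x2 b ->
  is_partial i (fun u v => f u v * g u v) x1 x2 (a * g x1 x2 + f x1 x2 * b).
Proof.
  destruct i; simpl; intros F G; refine (is_derive_mult _ _ _ _ _ F G _);
    exact Rmult_comm.
Qed.

Lemma is_partial_inv i f x1 x2 a : f x1 x2 <> 0 ->
  is_partial i f x1 x2 a ->
  is_partial i (fun u v => / f u v) x1 x2 (- a / f x1 x2 ^ 2).
Proof. destruct i; simpl; intros H F; now apply is_derive_inv. Qed.

Lemma is_partial_x1 i x1 x2 :
  is_partial i (fun u _ => u) x1 x2 (match i with i1 => 1 | i2 => 0 end).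
Proof.
  destruct i; [exact (is_derive_id x1)|exact (is_derive_const x1 x2)].
Qed.

Lemma is_partial_x2 i x1 x2 :
  is_partial i (fun _ v => v) x1 x2 (match i with i1 => 0 | i2 => 1 end).
Proof.
  destruct i; [exact (is_derive_const x2 x1)|exact (is_derive_id x2)].
Qed.

(** Iterated differentiability up to every order is a coinductive notion: a class of
    continuous functions that is stable under both partial derivatives consists of
    smooth functions.  Only the values on the half plane are compared, so a class may
    be given by formulas that are valid there. *)
Lemma smooth_coind (S : fn -> Prop) :
  (forall f, S f ->
     (forall x1 x2, 0 < x1 -> continuity_2d_pt f x1 x2) /\
     forall i, exists g, S g /\
       forall x1 x2, 0 < x1 -> is_partial i f x1 x2 (g x1 x2)) ->
  forall f, S f -> smooth f.
Proof.
  intros HS f Sf n.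
  assert (K : forall f h, S f -> (forall u v, 0 < u -> h u v = f u v) ->
    forall x1 x2, 0 < x1 -> ex_diff_n h n x1 x2); [|now apply (K f f)].
  clear f Sf. induction n as [|n IH]; intros f h Sf E x1 x2 h1;
    destruct (HS f Sf) as [Hc Hp].
  - split; auto. apply (continuity_2d_pt_ext_loc f); [|now apply Hc].
    apply half_plane_open; auto. intros; symmetry; auto.
  - assert (Ip : forall i, exists g, S g /\
       forall x1 x2, 0 < x1 -> is_partial i h x1 x2 (g x1 x2)).
    { intros i. destruct (Hp i) as [g [Sg Hg]]. exists g; split; auto.
      intros u v hu. apply (is_partial_ext i f); auto.
      intros; symmetry; auto. }
    destruct (Ip i1) as [g1 [Sg1 H1]]. destruct (Ip i2) as [g2 [Sg2 H2]].
    split; [|split; [|split; [|split]]].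
    + apply (continuity_2d_pt_ext_loc f); [|now apply Hc].
      apply half_plane_open; auto. intros; symmetry; auto.
    + exists (g1 x1 x2). now apply H1.
    + exists (g2 x1 x2). now apply H2.
    + apply (IH g1); auto. intros u v hu. exact (is_partial_unique i1 h u v _ (H1 u v hu)).
    + apply (IH g2); auto. intros u v hu. exact (is_partial_unique i2 h u v _ (H2 u v hu)).
Qed.

Lemma smooth_continuity f x1 x2 : smooth f -> 0 < x1 -> continuity_2d_pt f x1 x2.
Proof. intros H h. apply (H 0%nat x1 x2 h). Qed.

Lemma smooth_partial i f : smooth f -> smooth (partial i f).
Proof. intros H n x1 x2 h. destruct i; apply (H (S n) x1 x2 h). Qed.

Lemma smooth_is_partial i f x1 x2 :
  smooth f -> 0 < x1 -> is_partial i f x1 x2 (partial i f x1 x2).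
Proof.
  intros H h. destruct (H 1%nat x1 x2 h) as [_ [D1 [D2 _]]].
  destruct i; now apply Derive_correct.
Qed.

Lemma smooth_ext f g :
  (forall x1 x2, 0 < x1 -> f x1 x2 = g x1 x2) -> smooth f -> smooth g.
Proof.
  intros E H n x1 x2 h. apply (ex_diff_n_ext_loc f); [|now apply H].
  now apply half_plane_open.
Qed.

Lemma partial_comm f x1 x2 : smooth f -> 0 < x1 ->
  partial i1 (partial i2 f) x1 x2 = partial i2 (partial i1 f) x1 x2.
Proof.
  intros H h. apply Schwarz.
  - apply half_plane_open; auto. intros u v hu.
    destruct (H 1%nat u v hu) as [_ [D1 [D2 _]]].
    destruct (smooth_partial i2 f H 1%nat u v hu) as [_ [D3 _]].
    destruct (smooth_partial i1 f H 1%nat u v hu) as [_ [_ [D4 _]]].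
    auto.
  - exact (smooth_continuity _ x1 x2 (smooth_partial i1 _ (smooth_partial i2 f H)) h).
  - exact (smooth_continuity _ x1 x2 (smooth_partial i2 _ (smooth_partial i1 f H)) h).
Qed.

(** The closure of the smooth functions under the field operations.  It is stable under
    partial derivatives, hence no larger than the class of smooth functions; one
    coinduction thus proves all the closure properties at once. *)
Inductive rational_in_smooth : fn -> Prop :=
| ris_smooth f : smooth f -> rational_in_smooth f
| ris_const c : rational_in_smooth (fun _ _ => c)
| ris_plus f g : rational_in_smooth f -> rational_in_smooth g ->
    rational_in_smooth (fun u v => f u v + g u v)
| ris_mult f g : rational_in_smooth f -> rational_in_smooth g ->
    rational_in_smooth (fun u v => f u v * g u v)
| ris_inv f : rational_in_smooth f -> (forall u v, 0 < u -> f u v <> 0) ->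
    rational_in_smooth (fun u v => / f u v).

Lemma rational_in_smooth_smooth f : rational_in_smooth f -> smooth f.
Proof.
  apply smooth_coind. clear f. intros f Hf.
  induction Hf as [f Sf|c|f g Hf [Cf Pf] Hg [Cg Pg]|f g Hf [Cf Pf] Hg [Cg Pg]
                  |f Hf [Cf Pf] N].
  - split; [intros; now apply smooth_continuity|]. intros i.
    exists (partial i f). split; [now apply ris_smooth, smooth_partial|].
    intros; now apply smooth_is_partial.
  - split; [intros; apply continuity_2d_pt_const|]. intros i.
    exists (fun _ _ => 0). split; [apply ris_const|]. intros; apply is_partial_const.
  - split; [intros; apply continuity_2d_pt_plus; auto|]. intros i.
    destruct (Pf i) as [f' [Sf Hf']]. destruct (Pg i) as [g' [Sg Hg']].
    exists (fun u v => f' u v + g' u v). split; [now apply ris_plus|].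
    intros; apply is_partial_plus; auto.
  - split; [intros; apply continuity_2d_pt_mult; auto|]. intros i.
    destruct (Pf i) as [f' [Sf Hf']]. destruct (Pg i) as [g' [Sg Hg']].
    exists (fun u v => f' u v * g u v + f u v * g' u v).
    split; [apply ris_plus; now apply ris_mult|].
    intros; apply is_partial_mult; auto.
  - split; [intros; apply continuity_2d_pt_inv; auto|]. intros i.
    destruct (Pf i) as [f' [Sf Hf']].
    exists (fun u v => (-1 * f' u v) * (/ f u v * / f u v)).
    split; [repeat apply ris_mult; auto using ris_const, ris_inv|].
    intros x1 x2 h. replace (-1 * f' x1 x2 * (/ f x1 x2 * / f x1 x2))
      with (- f' x1 x2 / f x1 x2 ^ 2) by (field; auto).
    apply is_partial_inv; auto.
Qed.

Lemma smooth_const c : smooth (fun _ _ => c).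
Proof. apply rational_in_smooth_smooth, ris_const. Qed.

Lemma smooth_plus f g : smooth f -> smooth g -> smooth (fun u v => f u v + g u v).
Proof. intros; apply rational_in_smooth_smooth, ris_plus; now apply ris_smooth. Qed.

Lemma smooth_mult f g : smooth f -> smooth g -> smooth (fun u v => f u v * g u v).
Proof. intros; apply rational_in_smooth_smooth, ris_mult; now apply ris_smooth. Qed.

Lemma smooth_inv f : smooth f -> (forall u v, 0 < u -> f u v <> 0) ->
  smooth (fun u v => / f u v).
Proof. intros; apply rational_in_smooth_smooth, ris_inv; auto; now apply ris_smooth. Qed.

Lemma smooth_opp f : smooth f -> smooth (fun u v => - f u v).
Proof.
  intros H. apply (smooth_ext (fun u v => -1 * f u v)); [intros; ring|].
  apply smooth_mult; auto using smooth_const.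
Qed.

Lemma smooth_minus f g : smooth f -> smooth g -> smooth (fun u v => f u v - g u v).
Proof. intros; apply (smooth_plus f); auto using smooth_opp. Qed.

Lemma smooth_of_partials (f f1 f2 : fn) :
  (forall x1 x2, 0 < x1 -> continuity_2d_pt f x1 x2) ->
  smooth f1 -> smooth f2 ->
  (forall x1 x2, 0 < x1 -> is_partial i1 f x1 x2 (f1 x1 x2)) ->
  (forall x1 x2, 0 < x1 -> is_partial i2 f x1 x2 (f2 x1 x2)) ->
  smooth f.
Proof.
  intros Cf S1 S2 D1 D2.
  apply (smooth_coind (fun h => h = f \/ smooth h)); auto. intros h [->|Sh].
  - split; auto. intros [|]; [exists f1|exists f2]; auto.
  - split; [intros; now apply smooth_continuity|]. intros i.
    exists (partial i h). split; [right; now apply smooth_partial|].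
    intros; now apply smooth_is_partial.
Qed.

Lemma smooth_x1 : smooth (fun u _ => u).
Proof.
  apply (smooth_of_partials _ (fun _ _ => 1) (fun _ _ => 0));
    auto using smooth_const, continuity_2d_pt_id1; intros.
  - apply (is_partial_x1 i1).
  - apply (is_partial_x1 i2).
Qed.

Lemma smooth_x2 : smooth (fun _ v => v).
Proof.
  apply (smooth_of_partials _ (fun _ _ => 0) (fun _ _ => 1));
    auto using smooth_const, continuity_2d_pt_id2; intros.
  - apply (is_partial_x2 i1).
  - apply (is_partial_x2 i2).
Qed.

Lemma continuity_2d_of_derive (u v : R -> R) :
  (forall x, 0 < x -> is_derive u x (v x)) ->
  forall x1 x2, 0 < x1 -> continuity_2d_pt (fun x _ => u x) x1 x2.
Proof.
  intros D x1 x2 h. apply (continuity_1d_2d_pt_comp u (fun x _ => x)).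
  - apply derivable_continuous_pt. exists (v x1). now apply is_derive_Reals, D.
  - apply continuity_2d_pt_id1.
Qed.

Lemma smooth_antiderivative (u v : R -> R) :
  (forall x, 0 < x -> is_derive u x (v x)) ->
  smooth (fun x _ => v x) -> smooth (fun x _ => u x).
Proof.
  intros D Sv. apply (smooth_of_partials _ (fun x _ => v x) (fun _ _ => 0));
    auto using smooth_const.
  - exact (continuity_2d_of_derive u v D).
  - intros x1 x2 h. now apply D.
  - intros x1 x2 h. exact (is_partial_const i2 (u x1) x1 x2).
Qed.

Lemma is_derive_Rpower a x : 0 < x ->
  is_derive (fun t => Rpower t a) x (a * / x * Rpower x a).
Proof.
  intros h. replace (a * / x * Rpower x a) with (a * Rpower x (a - 1)).
  - apply is_derive_Reals. now apply derivable_pt_lim_power.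
  - unfold Rminus. rewrite Rpower_plus, Rpower_Ropp, Rpower_1; auto. ring.
Qed.

(** Real and imaginary part of a multiple of [x ^ (a + i w)]. *)
Definition power_trig (a w c s x : R) : R :=
  Rpower x a * (c * cos (w * ln x) + s * sin (w * ln x)).

Lemma is_derive_power_trig a w c s x : 0 < x ->
  is_derive (power_trig a w c s) x
    (/ x * power_trig a w (a * c + w * s) (a * s - w * c) x).
Proof.
  intros h. unfold power_trig.
  replace (/ x * _) with
    (a * / x * Rpower x a * (c * cos (w * ln x) + s * sin (w * ln x))
     + Rpower x a * (w * / x * (s * cos (w * ln x) - c * sin (w * ln x)))) by ring.
  apply (is_derive_mult (fun t => Rpower t a)
           (fun t => c * cos (w * ln t) + s * sin (w * ln t))).
  - now apply is_derive_Rpower.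
  - auto_derive; auto. ring.
  - exact Rmult_comm.
Qed.

Lemma smooth_inv_x1 : smooth (fun x _ => / x).
Proof. apply smooth_inv; [apply smooth_x1|intros; lra]. Qed.

Lemma smooth_power_trig a w c s : smooth (fun x _ => power_trig a w c s x).
Proof.
  (* differentiation lowers the exponent by one and keeps the frequency *)
  apply (smooth_coind (fun f => f = (fun _ _ => 0) \/ exists a c s,
           forall x y, 0 < x -> f x y = power_trig a w c s x)).
  2: right; now exists a, c, s.
  clear a c s. intros f [->|[a [c [s E]]]].
  - split; [intros; apply continuity_2d_pt_const|]. intros i.
    exists (fun _ _ => 0). split; auto. intros; apply is_partial_const.
  - split.
    + intros x1 x2 h.
      apply (continuity_2d_pt_ext_loc (fun x _ => power_trig a w c s x)).
      * apply half_plane_open; auto. intros; symmetry; auto.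
      * apply (continuity_2d_of_derive (power_trig a w c s)
          (fun x => / x * power_trig a w (a * c + w * s) (a * s - w * c) x)); auto.
        intros; now apply is_derive_power_trig.
    + intros [|].
      * exists (fun x _ => power_trig (a - 1) w (a * c + w * s) (a * s - w * c) x).
        split; [right; now exists (a - 1), (a * c + w * s), (a * s - w * c)|].
        intros x1 x2 h.
        apply (is_partial_ext i1 (fun x _ => power_trig a w c s x)); auto.
        { intros; symmetry; auto. }
        simpl. replace (power_trig (a - 1) _ _ _ _) with
          (/ x1 * power_trig a w (a * c + w * s) (a * s - w * c) x1).
        { now apply is_derive_power_trig. }
        unfold power_trig, Rminus at 2.
        rewrite Rpower_plus, Rpower_Ropp, Rpower_1; auto. ring.
      * exists (fun _ _ => 0). split; auto. intros x1 x2 h.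
        apply (is_partial_ext i2 (fun x _ => power_trig a w c s x)); auto.
        { intros; symmetry; auto. }
        exact (is_partial_const i2 (power_trig a w c s x1) x1 x2).
Qed.

Lemma power_trig_Rpower a x : power_trig a 0 1 0 x = Rpower x a.
Proof. unfold power_trig. rewrite Rmult_0_l, cos_0. ring. Qed.

Lemma smooth_Rpower a : smooth (fun x _ => Rpower x a).
Proof.
  apply (smooth_ext (fun x _ => power_trig a 0 1 0 x)), smooth_power_trig.
  intros; apply power_trig_Rpower.
Qed.

Lemma smooth_ln : smooth (fun x _ => ln x).
Proof.
  apply (smooth_antiderivative ln Rinv); [exact is_derive_ln|exact smooth_inv_x1].
Qed.

Ltac smooth_tac :=
  repeat first [ assumption | apply smooth_const | apply smooth_x1 | apply smooth_x2
    | apply smooth_inv_x1 | apply smooth_ln | apply smooth_Rpower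
    | apply smooth_power_trig
    | apply smooth_plus | apply smooth_minus | apply smooth_mult | apply smooth_opp
    | apply smooth_partial ].

(** * Killing fields in coordinates *)

(** The head symbol is inspected syntactically, so that derivatives occurring as atoms are not unfolded. *)
Ltac is_partial_tac :=
  lazymatch goal with
  | |- is_partial _ (fun _ _ => ?c) _ _ _ => apply is_partial_const
  | |- is_partial _ (fun u v => _ + _) _ _ _ => eapply is_partial_plus; is_partial_tac
  | |- is_partial _ (fun u v => _ - _) _ _ _ => eapply is_partial_minus; is_partial_tac
  | |- is_partial _ (fun u v => - _) _ _ _ => eapply is_partial_opp; is_partial_tac
  | |- is_partial _ (fun u v => _ * _) _ _ _ => eapply is_partial_mult; is_partial_tac
  | |- is_partial _ (fun u v => / u) _ _ _ =>
      eapply is_partial_inv; [apply Rgt_not_eq; assumption | is_partial_tac]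
  | |- is_partial _ (fun u v => u) _ _ _ => apply is_partial_x1
  | |- is_partial _ (fun u v => v) _ _ _ => apply is_partial_x2
  | |- is_partial _ (fun u v => ?f u v) _ _ _ =>
      apply (smooth_is_partial _ f); [smooth_tac; auto | assumption]
  | |- is_partial _ ?f _ _ _ => apply smooth_is_partial; [smooth_tac; auto | assumption]
  end.

Ltac partial_step :=
  match goal with
  | |- context [partial ?i (fun u v => @?e u v) ?x1 ?x2] =>
      erewrite (is_partial_unique i (fun u v => e u v) x1 x2); [|is_partial_tac]; cbv beta
  end.

(** The right-hand side of the Killing equation [d_i d_j X^k = ...] of the
    Christoffel symbols [C / x1]. *)
Definition killing_rhs (C : idx -> idx -> idx -> R) (X : vfield) (i j k : idx) : fn :=
  fun x1 x2 =>
  C i j k * X i1 x1 x2 * (/ x1 * / x1)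
  - / x1 * sum2 (fun l => C l j k * partial i (X l) x1 x2
                         + C i l k * partial j (X l) x1 x2
                         - C i j l * partial l (X k) x1 x2).

Lemma smooth_coord_vf i : smooth_vf (coord_vf i).
Proof. intros j. destruct i, j; exact (smooth_const _). Qed.

(** [L_X nabla] is a tensor: the derivatives of [Y] and [Z] cancel. *)
Lemma lie_conn_typeB C X Y Z k x1 x2 :
  smooth_vf X -> smooth_vf Y -> smooth_vf Z -> 0 < x1 ->
  lie_conn (typeB C) X Y Z k x1 x2 =
  sum2 (fun i => sum2 (fun j => Y i x1 x2 * Z j x1 x2 *
    (partial i (partial j (X k)) x1 x2 - killing_rhs C X i j k x1 x2))).
Proof.
  intros SX SY SZ h.
  pose proof (SX i1). pose proof (SX i2). pose proof (SY i1). pose proof (SY i2).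
  pose proof (SZ i1). pose proof (SZ i2).
  unfold lie_conn, bracket, cov, sum2, typeB.
  repeat partial_step.
  unfold killing_rhs, sum2.
  assert (SZk := SZ k). assert (SXk := SX k).
  rewrite (partial_comm (Z k)), (partial_comm (X k)) by assumption.
  destruct k; field; lra.
Qed.

Lemma killing_iff C X :
  affine_killing (typeB C) X <->
  smooth_vf X /\ forall i j k x1 x2, 0 < x1 ->
    partial i (partial j (X k)) x1 x2 = killing_rhs C X i j k x1 x2.
Proof.
  split; intros [SX K]; split; auto.
  - intros i j k x1 x2 h.
    specialize (K (coord_vf i) (coord_vf j) (smooth_coord_vf i) (smooth_coord_vf j)
                  k x1 x2 h).
    rewrite lie_conn_typeB in K; auto using smooth_coord_vf.
    apply Rminus_diag_uniq. rewrite <- K. unfold sum2, coord_vf. destruct i, j; ring.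
  - intros Y Z SY SZ k x1 x2 h. rewrite lie_conn_typeB; auto.
    unfold sum2. rewrite !K; auto. ring.
Qed.

Lemma killing_axpy C a X Y :
  affine_killing (typeB C) X -> affine_killing (typeB C) Y ->
  affine_killing (typeB C) (fun i x1 x2 => a * X i x1 x2 + Y i x1 x2).
Proof.
  rewrite !killing_iff. intros [SX KX] [SY KY].
  assert (D : forall i k x1 x2, 0 < x1 ->
    partial i (fun u v => a * X k u v + Y k u v) x1 x2
    = a * partial i (X k) x1 x2 + partial i (Y k) x1 x2).
  { intros i k x1 x2 h. pose proof (SX k). pose proof (SY k). partial_step. ring. }
  split; [intros i; pose proof (SX i); pose proof (SY i); smooth_tac|].
  intros i j k x1 x2 h.
  rewrite (partial_ext i _ (fun u v => a * partial j (X k) u v + partial j (Y k) u v));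
    auto.
  pose proof (SX k). pose proof (SY k). partial_step.
  rewrite KX, KY by auto. unfold killing_rhs, sum2. rewrite !D by auto. ring.
Qed.

Lemma killing_zero C : affine_killing (typeB C) (fun _ _ _ => 0).
Proof.
  assert (P : forall i x1 x2, partial i (fun _ _ => 0) x1 x2 = 0)
    by (intros i x1 x2; apply is_partial_unique, is_partial_const).
  apply killing_iff. split; [intros i; apply smooth_const|].
  intros i j k x1 x2 h. rewrite (partial_ext i _ (fun _ _ => 0)); auto.
  rewrite P. unfold killing_rhs, sum2. rewrite !P. ring.
Qed.

(** * Dimension counting *)

Fixpoint dot (c : list R) (l : list (nat -> R)) (i : nat) : R :=
  match c, l with
  | a :: c', v :: l' => a * v i + dot c' l' i
  | _, _ => 0
  end.

Lemma dot_app c1 c2 l1 l2 i : length c1 = length l1 ->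
  dot (c1 ++ c2) (l1 ++ l2) i = dot c1 l1 i + dot c2 l2 i.
Proof.
  revert l1. induction c1 as [|a c1 IH]; intros [|v l1] E; try discriminate; simpl.
  - ring.
  - rewrite IH; [ring|now injection E].
Qed.

Lemma dot_reduce c l (t : (nat -> R) -> R) w i :
  dot c (map (fun v j => v j - t v * w j) l) i
  = dot c l i - dot c (map (fun v _ => t v) l) O * w i.
Proof.
  revert l. induction c as [|a c IH]; intros [|v l]; simpl; try ring.
  rewrite IH. ring.
Qed.

Lemma dot_scale c l n s : dot c (map (fun v (_ : nat) => v n / s) l) O = dot c l n / s.
Proof.
  revert l. induction c as [|a c IH]; intros [|v l]; simpl; try (unfold Rdiv; ring).
  rewrite IH. unfold Rdiv. ring.
Qed.

(** Gaussian elimination on the number of coordinates: a vector with a nonzero last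
    coordinate serves as pivot, and its coefficient is chosen at the end. *)
Lemma linear_dependence n : forall l : list (nat -> R), (n < length l)%nat ->
  exists c, length c = length l /\ (exists a, In a c /\ a <> 0) /\
    forall i, (i < n)%nat -> dot c l i = 0.
Proof.
  induction n as [|n IH]; intros l hl.
  - exists (map (fun _ => 1) l). split; [apply length_map|split].
    + exists 1. split; [|lra]. destruct l; [simpl in hl; lia|now left].
    + intros; lia.
  - destruct (Forall_Exists_dec (fun v : nat -> R => v n = 0)
      (fun v => Req_EM_T (v n) 0) l) as [A|A].
    + destruct (IH l ltac:(lia)) as [c [Lc [Nc Dc]]]. exists c. split; [|split]; auto.
      intros i hi. destruct (Nat.eq_dec i n) as [->|ne]; [|apply Dc; lia].
      clear -A. revert l A.
      induction c as [|a c IH]; intros [|v l] A; simpl; auto.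
      inversion A; subst. rewrite IH; auto. rewrite H1. ring.
    + apply Exists_exists in A. destruct A as [w [Hw Nw]].
      destruct (in_split w l Hw) as [l1 [l2 ->]].
      rewrite length_app in hl. simpl in hl.
      destruct (IH (map (fun v j => v j - v n / w n * w j) (l1 ++ l2)))
        as [c [Lc [[a [Ia Na]] Dc]]].
      { rewrite length_map, length_app. lia. }
      rewrite length_map, length_app in Lc.
      pose (c1 := firstn (length l1) c). pose (c2 := skipn (length l1) c).
      assert (Ec : c = c1 ++ c2) by (symmetry; apply firstn_skipn).
      assert (Lc1 : length c1 = length l1)
        by (unfold c1; rewrite length_firstn; lia).
      assert (Dot : forall i, dot c (l1 ++ l2) i = dot c1 l1 i + dot c2 l2 i)
        by (intros i; rewrite Ec; now apply dot_app).
      pose (t := - (dot c (l1 ++ l2) n / w n)).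
      exists (c1 ++ t :: c2). split; [|split].
      * rewrite !length_app. simpl. rewrite Lc1. f_equal. f_equal.
        unfold c2. rewrite length_skipn. lia.
      * exists a. split; auto. rewrite Ec in Ia. apply in_app_or in Ia.
        apply in_or_app. destruct Ia; [now left|right; now right].
      * intros i hi. rewrite dot_app by auto. simpl.
        replace (dot c1 l1 i + (t * w i + dot c2 l2 i))
          with (dot c (l1 ++ l2) i + t * w i) by (rewrite Dot; ring).
        destruct (Nat.eq_dec i n) as [->|ne]; [unfold t; now field|].
        specialize (Dc i ltac:(lia)).
        rewrite (dot_reduce c (l1 ++ l2) (fun v => v n / w n) w), dot_scale in Dc.
        unfold t. lra.
Qed.

Lemma map_nth_seq (c : list R) : map (fun i => nth i c 0) (seq 0 (length c)) = c.
Proof.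
  induction c as [|a c IH]; simpl; auto. f_equal.
  rewrite <- seq_shift, map_map. exact IH.
Qed.

Definition vf_zero (X : vfield) : Prop := forall i x1 x2, 0 < x1 -> X i x1 x2 = 0.

(** If [m] exceeded [n], some nontrivial combination of a basis would be annihilated by
    all the functionals. *)
Lemma dim_vf_le (V : vfield -> Prop) (n m : nat) (phi : nat -> vfield -> R) :
  V (fun _ _ _ => 0) ->
  (forall a X Y, V X -> V Y -> V (fun i x1 x2 => a * X i x1 x2 + Y i x1 x2)) ->
  (forall k, phi k (fun _ _ _ => 0) = 0) ->
  (forall k a X Y, V X -> V Y ->
     phi k (fun i x1 x2 => a * X i x1 x2 + Y i x1 x2) = a * phi k X + phi k Y) ->
  (forall X, V X -> (forall k, (k < n)%nat -> phi k X = 0) -> vf_zero X) ->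
  dim_vf V m -> (m <= n)%nat.
Proof.
  intros V0 VL P0 PL Inj [l [Ll [Vl [Ind _]]]].
  destruct (Nat.le_gt_cases m n) as [|hlt]; auto. exfalso.
  destruct (linear_dependence n (map (fun X k => phi k X) l)) as [c [Lc [[a [Ia Na]] Dc]]].
  { rewrite length_map. lia. }
  rewrite length_map in Lc.
  assert (K : V (lincomb_vf c l) /\
    forall k, phi k (lincomb_vf c l) = dot c (map (fun X k => phi k X) l) k).
  { clear -V0 VL P0 PL Vl. revert c. induction l as [|X l IH]; intros [|a c];
      try (split; [exact V0|exact P0]).
    destruct (IH (fun Y h => Vl Y (or_intror h)) c) as [Vc Pc].
    split; [exact (VL a X _ (Vl X (or_introl eq_refl)) Vc)|].
    intros k. simpl. rewrite <- Pc.
    exact (PL k a X _ (Vl X (or_introl eq_refl)) Vc). }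
  destruct K as [Vc Pc]. apply Na. apply (Ind c); [lia| |auto].
  apply (Inj _ Vc). intros k hk. rewrite Pc. now apply Dc.
Qed.

Lemma dim_vf_ge (V : vfield -> Prop) (n : nat) (ys : list vfield) :
  dim_vf V n -> (forall Y, In Y ys -> V Y) -> (n < length ys)%nat ->
  exists d, length d = length ys /\ (exists a, In a d /\ a <> 0) /\
    vf_zero (lincomb_vf d ys).
Proof.
  intros [l [Ll [_ [_ Sp]]]] Vys hn.
  assert (K : exists ws, length ws = length ys /\
    Forall2 (fun Y (w : nat -> R) => forall i x1 x2, 0 < x1 ->
      Y i x1 x2 = lincomb_vf (map w (seq 0 n)) l i x1 x2) ys ws).
  { clear hn. induction ys as [|Y ys IH]; [exists []; auto|].
    destruct IH as [ws [Lw Fw]]; [intros; apply Vys; now right|].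
    destruct (Sp Y (Vys Y (or_introl eq_refl))) as [c [Lc Ec]].
    exists ((fun i => nth i c 0) :: ws). split; [simpl; lia|].
    constructor; auto. intros i x1 x2 h. rewrite Ec by auto.
    rewrite <- Lc, map_nth_seq. reflexivity. }
  destruct K as [ws [Lw Fw]].
  destruct (linear_dependence n ws) as [d [Ld [Nd Dd]]]; [lia|].
  exists d. split; [lia|split; auto]. intros i x1 x2 h.
  assert (A : forall c1 c2 l (a : R) (w : nat -> R) (v : nat -> R),
    (forall k, v k = a * w k + dot c1 c2 k) ->
    forall s, lincomb_vf (map v s) l i x1 x2
      = a * lincomb_vf (map w s) l i x1 x2
        + lincomb_vf (map (dot c1 c2) s) l i x1 x2).
  { clear. intros c1 c2 l a w v E s. revert l.
    induction s as [|k s IH]; intros [|X l]; unfold lincomb_vf in *; simpl; try ring.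
    rewrite IH, E. ring. }
  assert (B : lincomb_vf d ys i x1 x2 = lincomb_vf (map (dot d ws) (seq 0 n)) l i x1 x2).
  { clear Nd Dd hn Lw Vys. revert ys d Fw Ld.
    induction ws as [|w ws IH]; intros ys d Fw Ld;
      inversion Fw as [|Y w' ys' ws' HY HF]; subst.
    - destruct d; [|discriminate]. unfold lincomb_vf at 1. simpl.
      symmetry. clear. generalize (seq 0 (length l)). intros s. revert l.
      induction s as [|k s IH]; intros [|X l]; unfold lincomb_vf in *; simpl; auto.
      rewrite IH. ring.
    - destruct d as [|a d]; [discriminate|].
      rewrite (A d ws l a w) by reflexivity.
      unfold lincomb_vf at 1. simpl. rewrite (HY i x1 x2 h).
      f_equal. apply (IH ys' d); auto. }
  rewrite B. rewrite (map_ext_in _ (fun _ => 0)).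
  - clear. generalize (seq 0 n). intros s. revert l.
    induction s as [|k s IH]; intros [|X l]; unfold lincomb_vf in *; simpl; auto.
    rewrite IH. ring.
  - intros k hk. apply Dd. apply in_seq in hk. lia.
Qed.

(** * A Killing field is determined by its 1-jet at a point *)

Lemma gronwall_zero (e e' : R -> R) (M s t : R) :
  (forall u, Rmin s t <= u <= Rmax s t -> is_derive e u (e' u)) ->
  (forall u, Rmin s t <= u <= Rmax s t -> Rabs (e' u) <= M * e u) ->
  0 <= e t -> e s = 0 -> e t = 0.
Proof.
  intros D B P Z.
  assert (G : forall K u, Rmin s t <= u <= Rmax s t ->
    is_derive (fun u => e u * exp (K * u)) u
      (e' u * exp (K * u) + e u * (exp (K * u) * K))).
  { intros K u hu. apply (is_derive_mult e (fun u => exp (K * u))); [now apply D| |exact Rmult_comm].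
    auto_derive; auto. ring. }
  assert (Step : forall K, exists c, Rmin s t <= c <= Rmax s t /\
    e t * exp (K * t) = (e' c + K * e c) * exp (K * c) * (t - s)).
  { intros K.
    destruct (MVT_gen (fun u => e u * exp (K * u)) s t
      (fun u => e' u * exp (K * u) + e u * (exp (K * u) * K))) as [c [hc Ec]].
    - intros u hu. apply G. lra.
    - intros u hu. apply derivable_continuous_pt. eexists. apply is_derive_Reals.
      now apply G.
    - exists c. split; auto. rewrite Z in Ec. lra. }
  destruct (Rle_lt_dec s t) as [h|h].
  - destruct (Step (- M)) as [c [hc Ec]].
    pose proof (B c hc) as Bc. apply Rabs_le_between in Bc.
    assert (e t * exp (- M * t) <= 0).
    { rewrite Ec. pose proof (exp_pos (- M * c)).
      assert (0 <= - (e' c + - M * e c) * exp (- M * c) * (t - s))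
        by (repeat apply Rmult_le_pos; lra). lra. }
    pose proof (exp_pos (- M * t)). nra.
  - destruct (Step M) as [c [hc Ec]].
    pose proof (B c hc) as Bc. apply Rabs_le_between in Bc.
    assert (e t * exp (M * t) <= 0).
    { rewrite Ec. pose proof (exp_pos (M * c)).
      assert (0 <= (e' c + M * e c) * exp (M * c) * (s - t))
        by (repeat apply Rmult_le_pos; lra). lra. }
    pose proof (exp_pos (M * t)). nra.
Qed.

Definition jet_energy (X : vfield) : fn := fun x1 x2 =>
  sum2 (fun k => X k x1 x2 * X k x1 x2
    + sum2 (fun j => partial j (X k) x1 x2 * partial j (X k) x1 x2)).

Definition jet_zero (X : vfield) (x1 x2 : R) : Prop :=
  forall k, X k x1 x2 = 0 /\ forall j, partial j (X k) x1 x2 = 0.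

Lemma jet_zero_energy X x1 x2 : jet_zero X x1 x2 <-> jet_energy X x1 x2 = 0.
Proof.
  unfold jet_zero, jet_energy, sum2. split.
  - intros H. destruct (H i1) as [-> H1]. destruct (H i2) as [-> H2].
    rewrite !H1, !H2. ring.
  - intros H.
    assert (S : forall r, 0 <= r * r) by (intros r; apply Rle_0_sqr).
    pose proof (S (X i1 x1 x2)). pose proof (S (X i2 x1 x2)).
    pose proof (S (partial i1 (X i1) x1 x2)). pose proof (S (partial i2 (X i1) x1 x2)).
    pose proof (S (partial i1 (X i2) x1 x2)). pose proof (S (partial i2 (X i2) x1 x2)).
    intros [|]; (split; [|intros [|]]); apply Rsqr_eq_0; unfold Rsqr; lra.
Qed.

Lemma jet_energy_nonneg X x1 x2 : 0 <= jet_energy X x1 x2.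
Proof.
  assert (S : forall r, 0 <= r * r) by (intros r; apply Rle_0_sqr).
  unfold jet_energy, sum2. repeat apply Rplus_le_le_0_compat; apply S.
Qed.

Definition jet_energy_deriv (X : vfield) (i : idx) : fn := fun x1 x2 =>
  sum2 (fun k => 2 * (X k x1 x2 * partial i (X k) x1 x2)
    + sum2 (fun j => 2 * (partial j (X k) x1 x2 * partial i (partial j (X k)) x1 x2))).

Lemma is_partial_jet_energy X i x1 x2 : smooth_vf X -> 0 < x1 ->
  is_partial i (jet_energy X) x1 x2 (jet_energy_deriv X i x1 x2).
Proof.
  intros SX h. pose proof (SX i1). pose proof (SX i2).
  unfold jet_energy, jet_energy_deriv, sum2.
  match goal with |- is_partial _ _ _ _ ?d =>
    evar (d' : R); replace d with d' end;
  [subst d'; is_partial_tac | subst d'; cbv beta; ring].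
Qed.

Definition jet_abs (X : vfield) : fn := fun x1 x2 =>
  sum2 (fun k => Rabs (X k x1 x2) + sum2 (fun j => Rabs (partial j (X k) x1 x2))).

Lemma jet_abs_bounds X x1 x2 :
  0 <= jet_abs X x1 x2 /\
  (forall k, Rabs (X k x1 x2) <= jet_abs X x1 x2) /\
  (forall j k, Rabs (partial j (X k) x1 x2) <= jet_abs X x1 x2) /\
  jet_abs X x1 x2 * jet_abs X x1 x2 <= 6 * jet_energy X x1 x2.
Proof.
  unfold jet_abs, jet_energy, sum2.
  assert (Q : forall r, r * r = Rabs r * Rabs r).
  { intros r. rewrite <- Rabs_mult. symmetry. apply Rabs_pos_eq, Rle_0_sqr. }
  rewrite (Q (X i1 x1 x2)), (Q (X i2 x1 x2)), (Q (partial i1 (X i1) x1 x2)),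
    (Q (partial i2 (X i1) x1 x2)), (Q (partial i1 (X i2) x1 x2)),
    (Q (partial i2 (X i2) x1 x2)).
  pose proof (Rabs_pos (X i1 x1 x2)). pose proof (Rabs_pos (X i2 x1 x2)).
  pose proof (Rabs_pos (partial i1 (X i1) x1 x2)).
  pose proof (Rabs_pos (partial i2 (X i1) x1 x2)).
  pose proof (Rabs_pos (partial i1 (X i2) x1 x2)).
  pose proof (Rabs_pos (partial i2 (X i2) x1 x2)).
  repeat split; try intros [|]; try intros [|]; try lra.
  generalize (Rabs (X i1 x1 x2)) (Rabs (X i2 x1 x2))
    (Rabs (partial i1 (X i1) x1 x2)) (Rabs (partial i2 (X i1) x1 x2))
    (Rabs (partial i1 (X i2) x1 x2)) (Rabs (partial i2 (X i2) x1 x2)).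
  clear. intros a b c d e f.
  (* Cauchy-Schwarz: the difference is the sum of the squared differences *)
  assert (S : forall r, 0 <= r * r) by (intros r; apply Rle_0_sqr).
  pose proof (S (a - b)). pose proof (S (a - c)). pose proof (S (a - d)).
  pose proof (S (a - e)). pose proof (S (a - f)). pose proof (S (b - c)).
  pose proof (S (b - d)). pose proof (S (b - e)). pose proof (S (b - f)).
  pose proof (S (c - d)). pose proof (S (c - e)). pose proof (S (c - f)).
  pose proof (S (d - e)). pose proof (S (d - f)). pose proof (S (e - f)).
  lra.
Qed.

Lemma Rabs_mult_le a b A B : Rabs a <= A -> Rabs b <= B -> Rabs (a * b) <= A * B.
Proof. intros. rewrite Rabs_mult. apply Rmult_le_compat; auto using Rabs_pos. Qed.

Lemma Rabs_plus_le a b A B : Rabs a <= A -> Rabs b <= B -> Rabs (a + b) <= A + B.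
Proof. intros. eapply Rle_trans; [apply Rabs_triang|lra]. Qed.

Lemma Rabs_minus_le a b A B : Rabs a <= A -> Rabs b <= B -> Rabs (a - b) <= A + B.
Proof. intros. apply Rabs_plus_le; auto. now rewrite Rabs_Ropp. Qed.

Lemma christoffel_bound (C : idx -> idx -> idx -> R) :
  exists K, 0 <= K /\ forall i j k, Rabs (C i j k) <= K.
Proof.
  exists (Rabs (C i1 i1 i1) + Rabs (C i1 i1 i2) + Rabs (C i1 i2 i1) + Rabs (C i1 i2 i2)
        + Rabs (C i2 i1 i1) + Rabs (C i2 i1 i2) + Rabs (C i2 i2 i1) + Rabs (C i2 i2 i2)).
  pose proof (Rabs_pos (C i1 i1 i1)). pose proof (Rabs_pos (C i1 i1 i2)).
  pose proof (Rabs_pos (C i1 i2 i1)). pose proof (Rabs_pos (C i1 i2 i2)).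
  pose proof (Rabs_pos (C i2 i1 i1)). pose proof (Rabs_pos (C i2 i1 i2)).
  pose proof (Rabs_pos (C i2 i2 i1)). pose proof (Rabs_pos (C i2 i2 i2)).
  split; [lra|]. intros [|] [|] [|]; lra.
Qed.

Lemma killing_rhs_bound C X alpha : 0 < alpha ->
  exists N, 0 <= N /\ forall i j k x1 x2, alpha <= x1 ->
    Rabs (killing_rhs C X i j k x1 x2) <= N * jet_abs X x1 x2.
Proof.
  intros ha. destruct (christoffel_bound C) as [K [hK BK]].
  pose proof (Rinv_0_lt_compat _ ha) as hia.
  exists (K * (/ alpha * / alpha) + / alpha * (K + K + K + (K + K + K))). split.
  { apply Rplus_le_le_0_compat; repeat apply Rmult_le_pos; lra. }
  intros i j k x1 x2 h. destruct (jet_abs_bounds X x1 x2) as [S0 [SX [SP _]]].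
  assert (hi : Rabs (/ x1) <= / alpha).
  { rewrite Rabs_pos_eq; [now apply Rinv_le_contravar|].
    left. apply Rinv_0_lt_compat. lra. }
  set (S := jet_abs X x1 x2) in *. unfold killing_rhs, sum2.
  replace ((K * (/ alpha * / alpha) + / alpha * (K + K + K + (K + K + K))) * S) with
    (K * S * (/ alpha * / alpha)
     + / alpha * ((K * S + K * S + K * S) + (K * S + K * S + K * S))) by ring.
  repeat first [apply Rabs_minus_le | apply Rabs_plus_le | apply Rabs_mult_le]; auto.
Qed.

Lemma jet_energy_deriv_bound C X alpha : 0 < alpha -> affine_killing (typeB C) X ->
  exists M, forall i x1 x2, alpha <= x1 ->
    Rabs (jet_energy_deriv X i x1 x2) <= M * jet_energy X x1 x2.
Proof.
  intros ha KX. apply killing_iff in KX. destruct KX as [SX KX].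
  destruct (killing_rhs_bound C X alpha ha) as [N [hN BN]].
  exists (12 * (N + 1) * 6). intros i x1 x2 h.
  destruct (jet_abs_bounds X x1 x2) as [S0 [S1 [S2 S3]]].
  set (S := jet_abs X x1 x2) in *.
  assert (W : forall k, Rabs (partial i (X k) x1 x2) <= (N + 1) * S).
  { intros k. apply (Rle_trans _ S); [apply S2|].
    assert (0 <= N * S) by now apply Rmult_le_pos. lra. }
  assert (W' : forall j k, Rabs (partial i (partial j (X k)) x1 x2) <= (N + 1) * S).
  { intros j k. rewrite KX by lra. apply (Rle_trans _ (N * S)); [|lra].
    now apply BN. }
  apply (Rle_trans _ (12 * (N + 1) * (S * S))).
  - unfold jet_energy_deriv, sum2.
    replace (12 * (N + 1) * (S * S)) with
      (2 * (S * ((N + 1) * S)) + (2 * (S * ((N + 1) * S)) + 2 * (S * ((N + 1) * S)))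
       + (2 * (S * ((N + 1) * S)) + (2 * (S * ((N + 1) * S)) + 2 * (S * ((N + 1) * S)))))
      by ring.
    assert (B2 : Rabs 2 <= 2) by (rewrite Rabs_pos_eq; lra).
    assert (T : forall v w, Rabs v <= S -> Rabs w <= (N + 1) * S ->
      Rabs (2 * (v * w)) <= 2 * (S * ((N + 1) * S))).
    { intros. apply Rabs_mult_le; auto. now apply Rabs_mult_le. }
    repeat apply Rabs_plus_le; apply T; auto.
  - replace (12 * (N + 1) * 6 * jet_energy X x1 x2)
      with (12 * (N + 1) * (6 * jet_energy X x1 x2)) by ring.
    apply Rmult_le_compat_l; [lra|exact S3].
Qed.

(** The Killing equation expresses the second derivatives of [X] linearly in its
    1-jet, so the 1-jet solves a linear ordinary differential equation along each
    coordinate line.  Every point is reached from [(1, 0)] along a horizontal and a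
    vertical segment. *)
Lemma killing_unique C X :
  affine_killing (typeB C) X -> jet_zero X 1 0 -> vf_zero X.
Proof.
  intros KX Z.
  assert (SX : smooth_vf X) by apply KX.
  assert (H : forall x1, 0 < x1 -> jet_energy X x1 0 = 0).
  { intros x1 h.
    assert (ha : 0 < Rmin 1 x1) by (apply Rmin_pos; lra).
    destruct (jet_energy_deriv_bound C X (Rmin 1 x1) ha KX) as [M BM].
    apply (gronwall_zero (fun t => jet_energy X t 0)
             (fun t => jet_energy_deriv X i1 t 0) M 1 x1).
    - intros u hu. apply (is_partial_jet_energy X i1 u 0 SX). lra.
    - intros u hu. apply BM. lra.
    - apply jet_energy_nonneg.
    - now apply jet_zero_energy. }
  intros k x1 x2 h.
  destruct (jet_energy_deriv_bound C X x1 h KX) as [M BM].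
  assert (E : jet_energy X x1 x2 = 0).
  { apply (gronwall_zero (fun t => jet_energy X x1 t)
             (fun t => jet_energy_deriv X i2 x1 t) M 0 x2).
    - intros u _. now apply (is_partial_jet_energy X i2 x1 u SX).
    - intros u _. apply BM. lra.
    - apply jet_energy_nonneg.
    - now apply H. }
  apply jet_zero_energy in E. apply E.
Qed.

(** * Invariance of the Ricci tensor *)

Definition ric (C : idx -> idx -> idx -> R) (j k : idx) : R :=
  - C j k i1 + (match j with i1 => sum2 (fun i => C i k i) | i2 => 0 end)
  + sum2 (fun i => sum2 (fun l => C i l i * C j k l - C j l i * C i k l)).

Lemma cov_coord G i j :
  cov G (coord_vf i) (coord_vf j) = G i j.
Proof.
  extensionality k. extensionality x1. extensionality x2.
  assert (P : forall l m, partial l (coord_vf j m) x1 x2 = 0).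
  { intros l m. destruct j, m; apply is_partial_unique; exact (is_partial_const l _ _ _). }
  unfold cov, sum2. rewrite !P. destruct i, j; unfold coord_vf; ring.
Qed.

Lemma bracket_coord i j k x1 x2 : bracket (coord_vf i) (coord_vf j) k x1 x2 = 0.
Proof.
  assert (P : forall l m n, partial l (coord_vf m n) x1 x2 = 0).
  { intros l m n. destruct m, n; apply is_partial_unique; exact (is_partial_const l _ _ _). }
  unfold bracket, sum2. rewrite !P. ring.
Qed.

Lemma ricci_typeB C i j x1 x2 : 0 < x1 ->
  ricci (typeB C) (coord_vf i) (coord_vf j) x1 x2 = / x1 * / x1 * ric C i j.
Proof.
  intros h. unfold ricci, curv, sum2. rewrite !cov_coord.
  assert (B : forall m n, bracket (coord_vf m) (coord_vf n) = fun _ _ _ => 0).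
  { intros m n. extensionality k. extensionality u. extensionality v.
    apply bracket_coord. }
  rewrite !B.
  assert (P : forall m l p q k, partial m (typeB C l p q) x1 k
     = match m with i1 => - (/ x1 * / x1) * C l p q | i2 => 0 end).
  { intros m l p q k. apply is_partial_unique. unfold typeB.
    evar (d' : R). replace (match m with i1 => _ | i2 => _ end) with d';
      [subst d'; is_partial_tac|subst d'; cbv beta; destruct m; field; lra]. }
  unfold cov, sum2. rewrite !P. unfold ric, sum2, typeB, coord_vf.
  destruct i, j; field; lra.
Qed.

(** [x1^2 (L_X rho)_ij]. *)
Definition lie_ricci (C : idx -> idx -> idx -> R) (X : vfield) (i j : idx) : fn :=
  fun x1 x2 =>
  -2 * ric C i j * (/ x1 * X i1 x1 x2)
  + sum2 (fun l => ric C l j * partial i (X l) x1 x2 + ric C i l * partial j (X l) x1 x2).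

(** [L_X rho = 0] is the integrability condition of the Killing equations: it equates
    the two expressions they give for the third derivatives [d_2 d_1 d_j X^k]. *)
Lemma killing_lie_ricci C X i j x1 x2 :
  (forall i j k, C i j k = C j i k) -> affine_killing (typeB C) X -> 0 < x1 ->
  lie_ricci C X i j x1 x2 = 0.
Proof.
  intros hsym KX h. apply killing_iff in KX. destruct KX as [SX KX].
  pose proof (SX i1) as S1. pose proof (SX i2) as S2.
  assert (T : forall j k, partial i2 (killing_rhs C X i1 j k) x1 x2
                        = partial i1 (killing_rhs C X i2 j k) x1 x2).
  { intros m k.
    rewrite <- (partial_ext i2 (partial i1 (partial m (X k)))) by auto.
    rewrite <- (partial_ext i1 (partial i2 (partial m (X k)))) by auto.
    symmetry. apply partial_comm; auto. apply smooth_partial, SX. }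
  assert (T' : forall j k, / x1 * / x1 * lie_ricci C X j k x1 x2 =
    match j with
    | i1 => partial i1 (killing_rhs C X i2 k i2) x1 x2
            - partial i2 (killing_rhs C X i1 k i2) x1 x2
    | i2 => partial i2 (killing_rhs C X i1 k i1) x1 x2
            - partial i1 (killing_rhs C X i2 k i1) x1 x2
    end).
  { intros m k. unfold killing_rhs, sum2.
    destruct m; repeat partial_step; rewrite !KX by auto;
      unfold killing_rhs, lie_ricci, ric, sum2; rewrite !(hsym i2 i1);
      destruct k; rewrite ?(hsym i2 i1); field; lra. }
  apply (Rmult_eq_reg_l (/ x1 * / x1)).
  - rewrite T', Rmult_0_r. destruct i; rewrite T; ring.
  - pose proof (Rinv_0_lt_compat _ h). apply Rgt_not_eq. nra.
Qed.

(** * The isotropy algebra *)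

(** The conditions that [L_X rho = 0] and [L_X (nabla rho) = 0] impose at the point
    [(1, 0)] on the linear part [A i k = d_i X^k] of a Killing field vanishing there. *)
Definition isotropy (C : idx -> idx -> idx -> R) (A : idx -> idx -> R) : Prop :=
  (forall i j, sum2 (fun l => ric C l j * A i l + ric C i l * A j l) = 0) /\
  (forall m i j,
    let B i l := - sum2 (fun n => C n i l * A m n + C m n l * A i n - C m i n * A n l) in
    -2 * ric C i j * A m i1
    + sum2 (fun l => ric C l j * B i l + ric C i l * B j l) = 0).

Lemma killing_isotropy C X :
  (forall i j k, C i j k = C j i k) -> affine_killing (typeB C) X ->
  (forall k, X k 1 0 = 0) -> isotropy C (fun i k => partial i (X k) 1 0).
Proof.
  intros hsym KX Z. assert (h1 : 0 < 1) by lra. split.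
  - intros i j. pose proof (killing_lie_ricci C X i j 1 0 hsym KX h1) as L.
    unfold lie_ricci in L. rewrite Z in L. lra.
  - intros m i j B.
    assert (D : partial m (lie_ricci C X i j) 1 0 = 0).
    { rewrite (partial_ext m _ (fun _ _ => 0)); auto.
      - apply is_partial_unique, is_partial_const.
      - intros u v hu. now apply killing_lie_ricci. }
    assert (KX' := KX). apply killing_iff in KX'. destruct KX' as [SX KE].
    pose proof (SX i1). pose proof (SX i2).
    unfold lie_ricci, sum2 in D. revert D. partial_step.
    rewrite !KE by auto. unfold killing_rhs, sum2. rewrite !Z. intros D.
    etransitivity; [|exact D]. unfold B, sum2. rewrite Rinv_1. ring.
Qed.

(** The isotropy algebra at [(1, 0)] has codimension at most two in the Killing algebra,
    and its elements are determined by their linear parts.  Hence, if it has dimension at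
    most one, the Killing algebra has dimension at most three. *)
Lemma isotropy_functional_dim C (w : idx -> idx -> R) n :
  (forall i j k, C i j k = C j i k) ->
  (forall A, isotropy C A -> sum2 (fun i => sum2 (fun k => w i k * A i k)) = 0 ->
     forall i k, A i k = 0) ->
  dim_vf (affine_killing (typeB C)) n -> (n <= 3)%nat.
Proof.
  intros hsym Hw.
  apply (dim_vf_le _ 3 n (fun k X => match k with
    | 0%nat => X i1 1 0
    | 1%nat => X i2 1 0
    | _ => sum2 (fun i => sum2 (fun k => w i k * partial i (X k) 1 0)) end)).
  - apply killing_zero.
  - intros. now apply killing_axpy.
  - assert (P : forall i, partial i (fun _ _ => 0) 1 0 = 0)
      by (intros i; apply is_partial_unique, is_partial_const).
    intros [|[|k]]; auto. unfold sum2. rewrite !P. ring.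
  - intros k a X Y KX KY. destruct k as [|[|k]]; auto.
    assert (D : forall i k, partial i (fun u v => a * X k u v + Y k u v) 1 0
      = a * partial i (X k) 1 0 + partial i (Y k) 1 0).
    { intros i k'. assert (h1 : 0 < 1) by lra.
      pose proof (proj1 KX k'). pose proof (proj1 KY k'). partial_step. ring. }
    unfold sum2. rewrite !D. ring.
  - intros X KX P.
    assert (Z : forall k, X k 1 0 = 0)
      by (intros [|]; [apply (P 0%nat)|apply (P 1%nat)]; lia).
    apply (killing_unique C); auto. intros k. split; auto. intros j.
    apply (Hw (fun i k => partial i (X k) 1 0)); [now apply killing_isotropy|].
    apply (P 2%nat). lia.
Qed.

Lemma isotropy_ricci C A : isotropy C A ->
  let s12 := ric C i1 i2 + ric C i2 i1 in
  2 * ric C i1 i1 * A i1 i1 + s12 * A i1 i2 = 0 /\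
  s12 * A i2 i1 + 2 * ric C i2 i2 * A i2 i2 = 0 /\
  s12 * A i1 i1 + 2 * ric C i2 i2 * A i1 i2
  + 2 * ric C i1 i1 * A i2 i1 + s12 * A i2 i2 = 0 /\
  (ric C i1 i2 - ric C i2 i1) * (A i1 i1 + A i2 i2) = 0.
Proof.
  intros [H _] s12. unfold sum2 in H. unfold s12.
  pose proof (H i1 i1). pose proof (H i1 i2). pose proof (H i2 i1). pose proof (H i2 i2).
  repeat split; lra.
Qed.

Lemma Rmult_zero_r a b : a <> 0 -> a * b = 0 -> b = 0.
Proof. intros n H. destruct (Rmult_integral a b H); [contradiction|assumption]. Qed.

Lemma all_zero (A : idx -> idx -> R) :
  A i1 i1 = 0 -> A i1 i2 = 0 -> A i2 i1 = 0 -> A i2 i2 = 0 -> forall i k, A i k = 0.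
Proof. intros ? ? ? ? [|] [|]; assumption. Qed.

(** Here [rho] is a multiple of [l (x) l] with [l = m dx1 + dx2].  Differentiating
    [L_X rho = 0] at a zero of [X] on the line [x1 = 1] gives
    [l (d_j d_i X) = (d_j X^1) l_i].  The left-hand side is symmetric in [i] and [j],
    so [d X^1] is a multiple of [l]. *)
Lemma isotropy_oblique C A m : (forall i j k, C i j k = C j i k) ->
  ric C i2 i2 <> 0 -> ric C i1 i2 = m * ric C i2 i2 -> ric C i2 i1 = m * ric C i2 i2 ->
  ric C i1 i1 = m * m * ric C i2 i2 ->
  isotropy C A -> A i1 i1 = m * A i2 i1.
Proof.
  intros hsym N E12 E21 E11 [H1 H2]. unfold sum2 in *.
  pose proof (H2 i1 i2 i2) as Ha. pose proof (H2 i2 i1 i2) as Hb.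
  pose proof (H2 i2 i2 i2) as Hc. cbv zeta in Ha, Hb, Hc.
  rewrite !(hsym i2 i1) in *. rewrite ?E12, ?E21, ?E11 in *.
  apply Rminus_diag_uniq. apply (Rmult_zero_r (-2 * ric C i2 i2)); [lra|].
  match type of Ha with ?a = 0 => match type of Hb with ?b = 0 =>
    match type of Hc with ?c = 0 =>
      replace (-2 * ric C i2 i2 * (A i1 i1 - m * A i2 i1))
        with (a - 2 * b + m * c) by ring end end end.
  rewrite Ha, Hb, Hc. ring.
Qed.

(** One linear functional suffices to control the isotropy algebra, unless the connection
    has the special form of the second alternative.  If the symmetric part of [rho] is
    nondegenerate, the isotropy lies in its orthogonal algebra, which is a line.  If it is
    a multiple of [l (x) l], the isotropy consists of endomorphisms with image in the
    kernel of [l].  These form a plane, which is cut down to a line by the trace condition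
    when [rho] has an alternating part, by the previous lemma when [l] is not a multiple
    of [dx1], and by [nabla rho] when [C_12^1] or [C_22^1] is nonzero.  If the symmetric
    part vanishes, [rho] is an area form, so the isotropy is traceless; moreover
    [nabla rho = omega (x) rho] with an invariant covector [omega], whose second component
    is proportional to [rho_12] and hence nonzero. *)
Lemma isotropy_small C : (forall i j k, C i j k = C j i k) ->
  (exists i j, ric C i j <> 0) ->
  (exists w : idx -> idx -> R, forall A, isotropy C A ->
     sum2 (fun i => sum2 (fun k => w i k * A i k)) = 0 -> forall i k, A i k = 0) \/
  (C i1 i2 i1 = 0 /\ C i2 i2 i1 = 0 /\ C i2 i2 i2 = 0).
Proof.
  intros hsym NF.
  set (r11 := ric C i1 i1). set (r22 := ric C i2 i2).
  set (s := ric C i1 i2 + ric C i2 i1). set (w := ric C i1 i2 - ric C i2 i1).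
  destruct (Req_dec (4 * r11 * r22 - s * s) 0) as [Dt|Dt].
  2: { left. exists (fun i k => match i, k with
                        | i2, i1 => 2 * r11 | i2, i2 => s | _, _ => 0 end).
       intros A HA Hw. apply isotropy_ricci in HA.
       destruct HA as [E1 [E2 [E3 _]]]. fold r11 r22 s in E1, E2, E3.
       unfold sum2 in Hw.
       apply all_zero; apply (Rmult_zero_r _ _ Dt).
       - replace (_ * _) with (2 * r22 * (2 * r11 * A i1 i1 + s * A i1 i2)
           - s * (s * A i1 i1 + 2 * r22 * A i1 i2)) by ring. rewrite E1.
         replace (s * A i1 i1 + 2 * r22 * A i1 i2) with 0 by lra. ring.
       - replace (_ * _) with (2 * r11 * (s * A i1 i1 + 2 * r22 * A i1 i2)
           - s * (2 * r11 * A i1 i1 + s * A i1 i2)) by ring. rewrite E1.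
         replace (s * A i1 i1 + 2 * r22 * A i1 i2) with 0 by lra. ring.
       - replace (_ * _) with (2 * r22 * (2 * r11 * A i2 i1 + s * A i2 i2)
           - s * (s * A i2 i1 + 2 * r22 * A i2 i2)) by ring. rewrite E2.
         replace (2 * r11 * A i2 i1 + s * A i2 i2) with 0 by lra. ring.
       - replace (_ * _) with (2 * r11 * (s * A i2 i1 + 2 * r22 * A i2 i2)
           - s * (2 * r11 * A i2 i1 + s * A i2 i2)) by ring. rewrite E2.
         replace (2 * r11 * A i2 i1 + s * A i2 i2) with 0 by lra. ring. }
  destruct (Req_dec r22 0) as [Z22|N22].
  2: { left. exists (fun i k => match i, k with i2, i1 => 1 | _, _ => 0 end).
       intros A HA Hw. pose proof (isotropy_ricci _ _ HA) as HR.
       destruct HR as [E1 [E2 [E3 E4]]]. fold r11 r22 s w in E1, E2, E3, E4.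
       unfold sum2 in Hw.
       assert (A21 : A i2 i1 = 0) by lra.
       pose (m := s / (2 * r22)).
       assert (Es : s = 2 * m * r22) by (unfold m; field; auto).
       assert (E11 : r11 = m * m * r22).
       { apply (Rmult_eq_reg_l (4 * r22)); [|lra]. rewrite Es in Dt. lra. }
       assert (A22 : A i2 i2 = 0).
       { apply (Rmult_zero_r (2 * r22)); [lra|]. rewrite A21 in E2. lra. }
       assert (A11 : A i1 i1 = 0).
       { destruct (Req_dec w 0) as [Zw|Nw].
         - rewrite (isotropy_oblique C A m hsym N22); auto; fold r11 r22.
           + rewrite A21; ring.
           + unfold s, w in *. lra.
           + unfold s, w in *. lra.
         - rewrite A22, Rplus_0_r in E4. now apply (Rmult_zero_r w). }
       apply all_zero; auto.
       apply (Rmult_zero_r (2 * r22)); [lra|]. rewrite A11, A21, A22 in E3. lra. }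
  assert (Zs : s = 0).
  { rewrite Z22 in Dt. apply Rsqr_eq_0. unfold Rsqr. lra. }
  destruct (Req_dec r11 0) as [Z11|N11].
  - (* the Ricci tensor is alternating *)
    assert (Nw : w <> 0).
    { intros Zw. destruct NF as [i [j NF]]. apply NF. unfold s, w, r11, r22 in *.
      destruct i, j; auto; lra. }
    left. exists (fun i k => match i, k with i2, i1 => 1 | _, _ => 0 end).
    intros A HA Hw. pose proof (isotropy_ricci _ _ HA) as [_ [_ [_ E4]]].
    fold w in E4. unfold sum2 in Hw.
    assert (A21 : A i2 i1 = 0) by lra.
    assert (Tr : A i1 i1 + A i2 i2 = 0) by now apply (Rmult_zero_r w).
    pose (t1 := C i1 i1 i1 + C i1 i2 i2). pose (t2 := C i1 i2 i1 + C i2 i2 i2).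
    assert (Ew : w = t2).
    { unfold w, t2, ric, sum2. rewrite !(hsym i2 i1). ring. }
    assert (Dv : forall m, w * ((2 + t1) * A m i1 + t2 * A m i2) = 0).
    { intros m. destruct HA as [_ H2]. pose proof (H2 m i1 i2) as Ha.
      pose proof (H2 m i2 i1) as Hb. cbv zeta in Ha, Hb. unfold sum2 in Ha, Hb.
      fold r11 r22 in Ha, Hb. rewrite Z11, Z22 in Ha, Hb.
      transitivity (- ((-2 * ric C i1 i2 * A m i1 - -2 * ric C i2 i1 * A m i1)
         - w * (t1 * A m i1 + t2 * A m i2))); [unfold w; ring|].
      apply Ropp_eq_0_compat.
      rewrite <- (Rminus_diag_eq _ _ (eq_trans Ha (eq_sym Hb))).
      unfold w, t1, t2. destruct m; rewrite !(hsym i2 i1); ring. }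
    assert (D1 := Rmult_zero_r _ _ Nw (Dv i1)). assert (D2 := Rmult_zero_r _ _ Nw (Dv i2)).
    rewrite <- Ew in D1, D2.
    assert (A22 : A i2 i2 = 0).
    { apply (Rmult_zero_r w); auto. rewrite A21 in D2. lra. }
    assert (A11 : A i1 i1 = 0) by lra.
    apply all_zero; auto.
    apply (Rmult_zero_r w); auto. rewrite A11 in D1. lra.
  - destruct (Req_dec w 0) as [Zw|Nw].
    + assert (Z12 : ric C i1 i2 = 0) by (unfold s, w in *; lra).
      assert (Z21 : ric C i2 i1 = 0) by (unfold s, w in *; lra).
      assert (K : forall A, isotropy C A -> A i1 i1 = 0 /\ A i2 i1 = 0 /\
        C i1 i2 i1 * A i1 i2 = 0 /\ C i2 i2 i1 * A i1 i2 + C i1 i2 i1 * A i2 i2 = 0 /\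
        C i2 i2 i1 * A i2 i2 = 0).
      { intros A HA. pose proof (isotropy_ricci _ _ HA) as [E1 [_ [E3 _]]].
        fold r11 r22 s in E1, E3. rewrite Zs in E1, E3. rewrite Z22 in E3.
        assert (A11 : A i1 i1 = 0) by (apply (Rmult_zero_r (2 * r11)); lra).
        assert (A21 : A i2 i1 = 0) by (apply (Rmult_zero_r (2 * r11)); lra).
        destruct HA as [_ H2].
        pose proof (H2 i1 i1 i1) as Ha. pose proof (H2 i2 i1 i1) as Hb.
        pose proof (H2 i2 i1 i2) as Hc. cbv zeta in Ha, Hb, Hc.
        unfold sum2 in Ha, Hb, Hc. fold r11 r22 in Ha, Hb, Hc.
        rewrite !(hsym i2 i1) in *.
        rewrite Z12, Z21, A11, A21 in Ha. rewrite Z12, Z21, A11, A21 in Hb.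
        rewrite Z12, Z22, A11, A21 in Hc.
        repeat split; auto; apply (Rmult_zero_r (-4 * r11)); lra. }
      destruct (Req_dec (C i1 i2 i1) 0) as [c1|c1];
      [destruct (Req_dec (C i2 i2 i1) 0) as [c2|c2]|].
      * right. repeat split; auto. rewrite <- Z12. unfold ric, sum2.
        rewrite !(hsym i2 i1), c1, c2. ring.
      * left. exists (fun _ _ => 0). intros A HA _.
        destruct (K A HA) as [A11 [A21 [_ [E2 E3]]]].
        assert (A22 := Rmult_zero_r _ _ c2 E3). apply all_zero; auto.
        apply (Rmult_zero_r (C i2 i2 i1)); auto. rewrite A22 in E2. lra.
      * left. exists (fun _ _ => 0). intros A HA _.
        destruct (K A HA) as [A11 [A21 [E1 [E2 _]]]].
        assert (A12 := Rmult_zero_r _ _ c1 E1). apply all_zero; auto.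
        apply (Rmult_zero_r (C i1 i2 i1)); auto. rewrite A12 in E2. lra.
    + left. exists (fun i k => match i, k with i1, i2 => 1 | _, _ => 0 end).
      intros A HA Hw. apply isotropy_ricci in HA. destruct HA as [E1 [_ [E3 E4]]].
      fold r11 r22 s w in E1, E3, E4. unfold sum2 in Hw.
      rewrite Zs in E1, E3. rewrite Z22 in E3.
      assert (A11 : A i1 i1 = 0) by (apply (Rmult_zero_r (2 * r11)); lra).
      assert (A21 : A i2 i1 = 0) by (apply (Rmult_zero_r (2 * r11)); lra).
      assert (A12 : A i1 i2 = 0) by lra.
      apply all_zero; auto.
      rewrite A11 in E4. apply (Rmult_zero_r w); auto. lra.
Qed.

(** * Flat connections *)

Lemma partial_sym i j f x1 x2 : smooth f -> 0 < x1 ->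
  partial i (partial j f) x1 x2 = partial j (partial i f) x1 x2.
Proof. intros S h. destruct i, j; auto; [|symmetry]; now apply partial_comm. Qed.

Definition affine_function (C : idx -> idx -> idx -> R) (f : fn) : Prop :=
  smooth f /\ forall x1 x2, 0 < x1 -> forall i j, hessian (typeB C) f i j x1 x2 = 0.

Definition vf_apply (X : vfield) (f : fn) : fn :=
  fun x1 x2 => sum2 (fun k => X k x1 x2 * partial k f x1 x2).

(** Take the Lie derivative of [Hess f = 0] along [X]: the failure of [X] to preserve
    [Hess] is the Killing operator of [X], paired with [d f]. *)
Lemma hessian_vf_apply C X f i j x1 x2 :
  (forall i j k, C i j k = C j i k) -> smooth_vf X -> affine_function C f -> 0 < x1 ->
  hessian (typeB C) (vf_apply X f) i j x1 x2 =
  sum2 (fun k => (partial i (partial j (X k)) x1 x2 - killing_rhs C X i j k x1 x2)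
                 * partial k f x1 x2).
Proof.
  intros hsym SX [Sf Hf] h. pose proof (SX i1) as S1. pose proof (SX i2) as S2.
  assert (H : forall i j u v, 0 < u -> partial i (partial j f) u v
    = / u * (C i j i1 * partial i1 f u v + C i j i2 * partial i2 f u v)).
  { intros i' j' u v hu. pose proof (Hf u v hu i' j') as E.
    unfold hessian, sum2, typeB in E. lra. }
  assert (T : forall k, partial i (partial j (partial k f)) x1 x2 =
    partial k (fun u v => / u * (C i j i1 * partial i1 f u v + C i j i2 * partial i2 f u v))
      x1 x2).
  { intros k. rewrite (partial_ext i _ (partial k (partial j f))); auto.
    - rewrite partial_sym; auto using smooth_partial. apply partial_ext; auto.
    - intros u v hu. now apply partial_sym. }
  unfold hessian, vf_apply, sum2.
  assert (D : forall l u v, 0 < u ->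
    partial l (fun x1 x2 => X i1 x1 x2 * partial i1 f x1 x2
                          + X i2 x1 x2 * partial i2 f x1 x2) u v
    = partial l (X i1) u v * partial i1 f u v + X i1 u v * partial l (partial i1 f) u v
    + (partial l (X i2) u v * partial i2 f u v
       + X i2 u v * partial l (partial i2 f) u v)).
  { intros l u v hu. partial_step. reflexivity. }
  rewrite (partial_ext i _ _ _ _ h (D j)). rewrite !D by auto.
  partial_step. rewrite !T. repeat partial_step. rewrite !H by auto.
  unfold killing_rhs, typeB, sum2. rewrite (hsym j i1), (hsym j i2), (hsym i i1), (hsym i i2).
  destruct i, j; rewrite ?(hsym i2 i1); field; lra.
Qed.

Definition jacobian (f g : fn) : fn := fun x1 x2 =>
  partial i1 f x1 x2 * partial i2 g x1 x2 - partial i2 f x1 x2 * partial i1 g x1 x2.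

(** The vector field [X] with [X f = u] and [X g = v], by Cramer's rule. *)
Definition frame_field (f g u v : fn) : vfield := fun k x1 x2 =>
  match k with
  | i1 => (u x1 x2 * partial i2 g x1 x2 - v x1 x2 * partial i2 f x1 x2)
          * / jacobian f g x1 x2
  | i2 => (v x1 x2 * partial i1 f x1 x2 - u x1 x2 * partial i1 g x1 x2)
          * / jacobian f g x1 x2
  end.

Lemma frame_field_apply f g u v x1 x2 : jacobian f g x1 x2 <> 0 ->
  vf_apply (frame_field f g u v) f x1 x2 = u x1 x2 /\
  vf_apply (frame_field f g u v) g x1 x2 = v x1 x2.
Proof.
  intros N. unfold vf_apply, sum2, frame_field.
  split; apply (Rmult_eq_reg_r (jacobian f g x1 x2)); auto;
    unfold jacobian in *; field; auto.
Qed.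

Lemma affine_function_const C c : affine_function C (fun _ _ => c).
Proof.
  split; [apply smooth_const|]. intros x1 x2 h i j. unfold hessian, sum2.
  assert (P : forall c l u v, partial l (fun _ _ => c) u v = 0)
    by (intros; apply is_partial_unique, is_partial_const).
  rewrite (partial_ext i _ (fun _ _ => 0)) by auto. rewrite !P. ring.
Qed.

(** By the previous identity the Killing operator of [X] is annihilated by [d f] and
    [d g], as soon as [X f] and [X g] are affine again. *)
Lemma killing_frame_field C f g u v :
  (forall i j k, C i j k = C j i k) ->
  affine_function C f -> affine_function C g ->
  affine_function C u -> affine_function C v ->
  (forall x1 x2, 0 < x1 -> jacobian f g x1 x2 <> 0) ->
  affine_killing (typeB C) (frame_field f g u v).
Proof.
  intros hsym Hf Hg Hu Hv N.
  assert (SX : smooth_vf (frame_field f g u v)).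
  { destruct Hf as [Sf _], Hg as [Sg _], Hu as [Su _], Hv as [Sv _].
    intros [|]; unfold frame_field; apply smooth_mult;
      [smooth_tac|apply smooth_inv; auto; unfold jacobian; smooth_tac
      |smooth_tac|apply smooth_inv; auto; unfold jacobian; smooth_tac]. }
  apply killing_iff. split; auto. intros i j k x1 x2 h.
  assert (A : forall a b, affine_function C a -> affine_function C b ->
    (forall x1 x2, 0 < x1 -> vf_apply (frame_field f g u v) a x1 x2 = b x1 x2) ->
    sum2 (fun k => (partial i (partial j (frame_field f g u v k)) x1 x2
      - killing_rhs C (frame_field f g u v) i j k x1 x2) * partial k a x1 x2) = 0).
  { intros a b Ha Hb E. rewrite <- hessian_vf_apply by auto.
    destruct Hb as [_ Hb]. rewrite <- (Hb x1 x2 h i j). unfold hessian, sum2.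
    rewrite !(partial_ext _ _ _ _ _ h E). f_equal. apply partial_ext; auto.
    intros; now apply partial_ext. }
  pose proof (A f u Hf Hu (fun x1 x2 h => proj1 (frame_field_apply f g u v x1 x2 (N x1 x2 h)))) as Ef.
  pose proof (A g v Hg Hv (fun x1 x2 h => proj2 (frame_field_apply f g u v x1 x2 (N x1 x2 h)))) as Eg.
  unfold sum2 in Ef, Eg. specialize (N x1 x2 h).
  set (K1 := partial i (partial j (frame_field f g u v i1)) x1 x2
      - killing_rhs C (frame_field f g u v) i j i1 x1 x2) in *.
  set (K2 := partial i (partial j (frame_field f g u v i2)) x1 x2
      - killing_rhs C (frame_field f g u v) i j i2 x1 x2) in *.
  assert (K1 = 0 /\ K2 = 0) as [Z1 Z2].
  { split; apply (Rmult_zero_r _ _ N); unfold jacobian.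
    - transitivity (partial i2 g x1 x2 * (K1 * partial i1 f x1 x2 + K2 * partial i2 f x1 x2)
        - partial i2 f x1 x2 * (K1 * partial i1 g x1 x2 + K2 * partial i2 g x1 x2)); [ring|].
      rewrite Ef, Eg. ring.
    - transitivity (partial i1 f x1 x2 * (K1 * partial i1 g x1 x2 + K2 * partial i2 g x1 x2)
        - partial i1 g x1 x2 * (K1 * partial i1 f x1 x2 + K2 * partial i2 f x1 x2)); [ring|].
      rewrite Ef, Eg. ring. }
  unfold K1, K2 in *. destruct k; lra.
Qed.

(** Two independent affine functions [f], [g] are affine coordinates; in them the
    Killing fields are the affine vector fields, of which
    [d_f, f d_f, g d_f, d_g, f d_g] are five independent ones. *)
Lemma affine_coordinates_dim C f g n :
  (forall i j k, C i j k = C j i k) ->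
  affine_function C f -> affine_function C g ->
  (forall x1 x2, 0 < x1 -> jacobian f g x1 x2 <> 0) ->
  dim_vf (affine_killing (typeB C)) n -> (5 <= n)%nat.
Proof.
  intros hsym Hf Hg N Dn.
  destruct (Nat.le_gt_cases 5 n) as [|hlt]; auto. exfalso.
  set (one := fun _ _ : R => 1). set (zero := fun _ _ : R => 0).
  assert (H1 : affine_function C one) by exact (affine_function_const C 1).
  assert (H0 : affine_function C zero) by exact (affine_function_const C 0).
  set (ys := [frame_field f g one zero; frame_field f g f zero; frame_field f g g zero;
              frame_field f g zero one; frame_field f g zero f]).
  destruct (dim_vf_ge _ n ys Dn) as [d [Ld [[a [Ia Na]] Z]]].
  { intros Y [<-|[<-|[<-|[<-|[<-|[]]]]]]; now apply killing_frame_field. }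
  { simpl. lia. }
  destruct d as [|d1 [|d2 [|d3 [|d4 [|d5 [|]]]]]]; try discriminate Ld.
  assert (Q : forall x1 x2, 0 < x1 ->
    d1 + d2 * f x1 x2 + d3 * g x1 x2 = 0 /\ d4 + d5 * f x1 x2 = 0).
  { intros x1 x2 h. specialize (N x1 x2 h).
    pose proof (Z i1 x1 x2 h) as Za. pose proof (Z i2 x1 x2 h) as Zb.
    cbv [lincomb_vf ys one zero lincomb map frame_field] in Za, Zb.
    set (J := jacobian f g x1 x2) in *.
    set (f1 := partial i1 f x1 x2) in *. set (f2 := partial i2 f x1 x2) in *.
    set (g1 := partial i1 g x1 x2) in *. set (g2 := partial i2 g x1 x2) in *.
    split; apply (Rmult_eq_reg_r (J * / J)); try (rewrite Rinv_r by auto; lra).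
    - match type of Za with ?za = 0 => match type of Zb with ?zb = 0 =>
        transitivity (f1 * za + f2 * zb) end end; [|rewrite Za, Zb; ring].
      unfold J at 1. unfold jacobian. fold f1 f2 g1 g2. ring.
    - match type of Za with ?za = 0 => match type of Zb with ?zb = 0 =>
        transitivity (g1 * za + g2 * zb) end end; [|rewrite Za, Zb; ring].
      unfold J at 1. unfold jacobian. fold f1 f2 g1 g2. ring. }
  assert (h1 : 0 < 1) by lra. destruct Hf as [Sf _], Hg as [Sg _].
  assert (Qd : forall i, d2 * partial i f 1 0 + d3 * partial i g 1 0 = 0 /\
                         d5 * partial i f 1 0 = 0).
  { intros i. split.
    - transitivity (partial i (fun u v => d1 + d2 * f u v + d3 * g u v) 1 0).
      + partial_step. ring.
      + rewrite (partial_ext i _ (fun _ _ => 0)); auto;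
          [apply is_partial_unique, is_partial_const|]. intros; now apply Q.
    - transitivity (partial i (fun u v => d4 + d5 * f u v) 1 0).
      + partial_step. ring.
      + rewrite (partial_ext i _ (fun _ _ => 0)); auto;
          [apply is_partial_unique, is_partial_const|]. intros; now apply Q. }
  specialize (N 1 0 h1). unfold jacobian in N.
  destruct (Qd i1) as [Q1 Q3], (Qd i2) as [Q2 Q4].
  assert (Z2 : d2 = 0).
  { apply (Rmult_zero_r _ _ N).
    transitivity (partial i2 g 1 0 * (d2 * partial i1 f 1 0 + d3 * partial i1 g 1 0)
      - partial i1 g 1 0 * (d2 * partial i2 f 1 0 + d3 * partial i2 g 1 0)); [ring|].
    rewrite Q1, Q2. ring. }
  assert (Z3 : d3 = 0).
  { apply (Rmult_zero_r _ _ N).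
    transitivity (partial i1 f 1 0 * (d2 * partial i2 f 1 0 + d3 * partial i2 g 1 0)
      - partial i2 f 1 0 * (d2 * partial i1 f 1 0 + d3 * partial i1 g 1 0)); [ring|].
    rewrite Q1, Q2. ring. }
  assert (Z5 : d5 = 0).
  { apply (Rmult_zero_r _ _ N).
    transitivity (partial i2 g 1 0 * (d5 * partial i1 f 1 0)
      - partial i1 g 1 0 * (d5 * partial i2 f 1 0)); [ring|].
    rewrite Q3, Q4. ring. }
  destruct (Q 1 0 h1) as [Q5 Q6]. rewrite Z2, Z3 in Q5. rewrite Z5 in Q6.
  apply Na. destruct Ia as [<-|[<-|[<-|[<-|[<-|[]]]]]]; lra.
Qed.

(** * Affine coordinates of flat connections *)

Definition affine_in_x2 (A B : R -> R) : fn := fun x1 x2 => A x1 + x2 * B x1.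

Lemma hessian_affine_in_x2 C (A A1 A2 B B1 B2 : R -> R) i j x1 x2 :
  (forall x, 0 < x -> is_derive A x (A1 x)) ->
  (forall x, 0 < x -> is_derive A1 x (A2 x)) ->
  (forall x, 0 < x -> is_derive B x (B1 x)) ->
  (forall x, 0 < x -> is_derive B1 x (B2 x)) -> 0 < x1 ->
  hessian (typeB C) (affine_in_x2 A B) i j x1 x2 =
  match i, j with
  | i1, i1 => A2 x1 + x2 * B2 x1 | i2, i2 => 0 | _, _ => B1 x1
  end - / x1 * (C i j i1 * (A1 x1 + x2 * B1 x1) + C i j i2 * B x1).
Proof.
  intros DA DA1 DB DB1 h.
  assert (P1 : forall (U U1 : R -> R) V V1, (forall x, 0 < x -> is_derive U x (U1 x)) ->
    (forall x, 0 < x -> is_derive V x (V1 x)) -> forall u v, 0 < u ->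
    partial i1 (affine_in_x2 U V) u v = affine_in_x2 U1 V1 u v).
  { intros U U1 V V1 DU DV u v hu. apply is_partial_unique. unfold affine_in_x2.
    apply (is_derive_plus U (fun t => v * V t)); auto.
    replace (v * V1 u) with (0 * V u + v * V1 u) by ring.
    apply (is_derive_mult (fun _ => v) V); auto; [|exact Rmult_comm].
    exact (is_derive_const v u). }
  assert (P2 : forall (U V : R -> R) u v, partial i2 (affine_in_x2 U V) u v = V u).
  { intros U V u v. apply is_partial_unique. unfold affine_in_x2. simpl.
    auto_derive; auto. ring. }
  assert (Q1 : forall k u v, 0 < u ->
    partial k (partial i1 (affine_in_x2 A B)) u v
    = match k with i1 => A2 u + v * B2 u | i2 => B1 u end).
  { intros k u v hu. rewrite (partial_ext k _ (affine_in_x2 A1 B1))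
      by (assumption || (intros; now apply P1)).
    destruct k; [now apply P1|apply P2]. }
  assert (Q2 : forall k u v, 0 < u ->
    partial k (partial i2 (affine_in_x2 A B)) u v
    = match k with i1 => B1 u | i2 => 0 end).
  { intros k u v hu. rewrite (partial_ext k _ (affine_in_x2 B (fun _ => 0)))
      by (assumption || (intros; rewrite P2; unfold affine_in_x2; ring)).
    destruct k; [|apply P2].
    rewrite (P1 B B1 (fun _ => 0) (fun _ => 0))
      by (auto; intros; exact (is_derive_const 0 _)).
    unfold affine_in_x2. ring. }
  unfold hessian, sum2, typeB. rewrite P2, (P1 A A1 B B1) by assumption.
  destruct j; rewrite ?Q1, ?Q2 by auto; destruct i; unfold affine_in_x2; ring.
Qed.

Lemma smooth_affine_in_x2 A B :
  smooth (fun x _ => A x) -> smooth (fun x _ => B x) -> smooth (affine_in_x2 A B).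
Proof. intros SA SB. unfold affine_in_x2. smooth_tac. Qed.

Lemma partial1_affine_in_x2 A A1 B B1 x1 x2 :
  is_derive A x1 A1 -> is_derive B x1 B1 ->
  partial i1 (affine_in_x2 A B) x1 x2 = A1 + x2 * B1.
Proof.
  intros DA DB. apply is_partial_unique. unfold affine_in_x2.
  apply (is_derive_plus A (fun t => x2 * B t)); auto.
  replace (x2 * B1) with (0 * B x1 + x2 * B1) by ring.
  apply (is_derive_mult (fun _ => x2) B); auto; [|exact Rmult_comm].
  exact (is_derive_const x2 x1).
Qed.

Lemma partial2_affine_in_x2 A B x1 x2 : partial i2 (affine_in_x2 A B) x1 x2 = B x1.
Proof.
  apply is_partial_unique. unfold affine_in_x2. simpl. auto_derive; auto. ring.
Qed.

Definition Cnormal (p q kappa : R) (i j k : idx) : R :=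
  match i, j, k with
  | i1, i1, i1 => p
  | i1, i1, i2 => q
  | i1, i2, i2 | i2, i1, i2 => kappa
  | _, _, _ => 0
  end.

Lemma Cnormal_eq C : (forall i j k, C i j k = C j i k) ->
  C i1 i2 i1 = 0 -> C i2 i2 i1 = 0 -> C i2 i2 i2 = 0 ->
  C = Cnormal (C i1 i1 i1) (C i1 i1 i2) (C i1 i2 i2).
Proof.
  intros hsym Z1 Z2 Z3. extensionality i. extensionality j. extensionality k.
  destruct i, j, k; simpl; auto; rewrite hsym; auto.
Qed.

Lemma ric_Cnormal p q kappa i j : ric (Cnormal p q kappa) i j =
  match i, j with i1, i1 => kappa * (p - kappa + 1) | _, _ => 0 end.
Proof. destruct i, j; unfold ric, sum2, Cnormal; ring. Qed.

Lemma affine_function_Cnormal p q kappa (A A1 A2 B B1 B2 : R -> R) :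
  smooth (fun x _ => A2 x) -> smooth (fun x _ => B2 x) ->
  (forall x, 0 < x -> is_derive A x (A1 x)) ->
  (forall x, 0 < x -> is_derive A1 x (A2 x)) ->
  (forall x, 0 < x -> is_derive B x (B1 x)) ->
  (forall x, 0 < x -> is_derive B1 x (B2 x)) ->
  (forall x, 0 < x -> B1 x = / x * (kappa * B x)) ->
  (forall x, 0 < x -> B2 x = / x * (p * B1 x)) ->
  (forall x, 0 < x -> A2 x = / x * (p * A1 x + q * B x)) ->
  affine_function (Cnormal p q kappa) (affine_in_x2 A B).
Proof.
  intros SA SB DA DA1 DB DB1 E1 E2 E3. split.
  - apply smooth_affine_in_x2;
      [apply (smooth_antiderivative A A1 DA), (smooth_antiderivative A1 A2 DA1 SA)
      |apply (smooth_antiderivative B B1 DB), (smooth_antiderivative B1 B2 DB1 SB)].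
  - intros x1 x2 h i j. rewrite (hessian_affine_in_x2 _ A A1 A2 B B1 B2); auto.
    destruct i, j; simpl; [rewrite E2, E3 by auto; ring|rewrite E1 by auto; ring
                          |rewrite E1 by auto; ring|ring].
Qed.

Lemma antiderivative_Rpower a :
  exists u : R -> R, forall x, 0 < x -> is_derive u x (Rpower x a).
Proof.
  destruct (Req_dec a (-1)) as [->|n].
  - exists ln. intros x h. replace (-1) with (- (1)) by ring.
    rewrite Rpower_Ropp, Rpower_1 by auto. now apply is_derive_ln.
  - exists (fun x => / (a + 1) * Rpower x (a + 1)). intros x h.
    replace (Rpower x a) with (/ (a + 1) * ((a + 1) * / x * Rpower x (a + 1))).
    + apply (is_derive_scal (fun t => Rpower t (a + 1))). now apply is_derive_Rpower.
    + rewrite Rpower_plus, Rpower_1 by auto. field. split; lra.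
Qed.

Lemma antiderivative_inhomogeneous p q : exists h h1 h2 : R -> R,
  smooth (fun x _ => h2 x) /\
  forall x, 0 < x -> is_derive h x (h1 x) /\ is_derive h1 x (h2 x) /\
    h2 x = / x * (p * h1 x + q).
Proof.
  destruct (Req_dec p 0) as [->|n].
  - exists (fun x => q * (x * ln x - x)), (fun x => q * ln x), (fun x => q * / x).
    split; [smooth_tac|]. intros x h. split; [|split].
    + auto_derive; auto. field. lra.
    + auto_derive; auto. ring.
    + ring.
  - exists (fun x => - (q / p) * x), (fun _ => - (q / p)), (fun _ => 0).
    split; [smooth_tac|]. intros x h. split; [|split].
    + auto_derive; auto. ring.
    + exact (is_derive_const _ _).
    + field. split; lra.
Qed.

Lemma Rpower_ne_0 x a : Rpower x a <> 0.
Proof. apply Rgt_not_eq, exp_pos. Qed.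

(** The affine functions of a flat normal form are [A + x2 B] with [B] a multiple of
    [x1^kappa]; the equation for [A] is then solved by quadratures, differently for
    [kappa = 0] and for [p = kappa - 1]. *)
Lemma flat_normal_affine p q kappa : kappa * (p - kappa + 1) = 0 ->
  exists f g, affine_function (Cnormal p q kappa) f /\
    affine_function (Cnormal p q kappa) g /\
    forall x1 x2, 0 < x1 -> jacobian f g x1 x2 <> 0.
Proof.
  intros Z. destruct (Req_dec kappa 0) as [->|nk].
  - destruct (antiderivative_Rpower p) as [u Du].
    destruct (antiderivative_inhomogeneous p q) as [h [h1 [h2 [Sh Dh]]]].
    exists (affine_in_x2 u (fun _ => 0)), (affine_in_x2 h (fun _ => 1)).
    split; [|split].
    + apply (affine_function_Cnormal p q 0 u (fun x => Rpower x p)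
        (fun x => p * / x * Rpower x p) (fun _ => 0) (fun _ => 0) (fun _ => 0));
        auto; intros;
        try smooth_tac; try exact (is_derive_const _ _);
        try (now apply is_derive_Rpower); ring.
    + apply (affine_function_Cnormal p q 0 h h1 h2 (fun _ => 1) (fun _ => 0) (fun _ => 0));
        auto; intros; try smooth_tac; try exact (is_derive_const _ _); try (now apply Dh);
        rewrite ?(proj2 (proj2 (Dh x H))); ring.
    + intros x1 x2 hx. unfold jacobian. rewrite !partial2_affine_in_x2.
      rewrite (partial1_affine_in_x2 u (Rpower x1 p) _ 0);
        [|now apply Du|exact (is_derive_const _ _)].
      rewrite (partial1_affine_in_x2 h (h1 x1) _ 0);
        [|now apply Dh|exact (is_derive_const _ _)].
      replace (_ - _) with (Rpower x1 p) by ring. apply Rpower_ne_0.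
  - assert (p = kappa - 1) as ->.
    { destruct (Rmult_integral _ _ Z); [contradiction|lra]. }
    set (P a := fun x => Rpower x a).
    assert (DP : forall x, 0 < x -> is_derive (P kappa) x (kappa * / x * P kappa x))
      by (intros; now apply is_derive_Rpower).
    assert (DP1 : forall x, 0 < x -> is_derive (fun x => kappa * / x * P kappa x) x
                     (kappa * (kappa - 1) * / x * / x * P kappa x)).
    { intros x hx. replace (kappa * (kappa - 1) * / x * / x * P kappa x)
        with (kappa * (- / x ^ 2) * P kappa x
              + kappa * / x * (kappa * / x * P kappa x)) by (field; lra).
      apply (is_derive_mult (fun x => kappa * / x) (P kappa)); auto;
        [|exact Rmult_comm]. auto_derive; [lra|]. field. lra. }
    destruct (antiderivative_Rpower kappa) as [u Du].
    exists (affine_in_x2 (P kappa) (fun _ => 0)),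
      (affine_in_x2 (fun x => q * u x) (P kappa)).
    split; [|split].
    + apply (affine_function_Cnormal _ q kappa (P kappa) (fun x => kappa * / x * P kappa x)
        (fun x => kappa * (kappa - 1) * / x * / x * P kappa x)
        (fun _ => 0) (fun _ => 0) (fun _ => 0)); auto; intros;
        try (unfold P; smooth_tac); try exact (is_derive_const _ _); ring.
    + apply (affine_function_Cnormal _ q kappa (fun x => q * u x) (fun x => q * P kappa x)
        (fun x => q * (kappa * / x * P kappa x)) (P kappa) (fun x => kappa * / x * P kappa x)
        (fun x => kappa * (kappa - 1) * / x * / x * P kappa x)); auto; intros;
        try (unfold P; smooth_tac); try (apply is_derive_scal; auto); ring.
    + intros x1 x2 hx. unfold jacobian. rewrite !partial2_affine_in_x2.
      rewrite (partial1_affine_in_x2 (P kappa) (kappa * / x1 * P kappa x1) _ 0);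
        [|now apply DP|exact (is_derive_const _ _)].
      replace (_ - _) with ((kappa * / x1) * (P kappa x1 * P kappa x1)) by ring.
      apply Rmult_integral_contrapositive_currified;
        apply Rmult_integral_contrapositive_currified; try apply Rpower_ne_0; auto.
      apply Rinv_neq_0_compat. lra.
Qed.

(** In the coordinates [x1] and [y = x2 - m x1] the only nonzero coefficients are
    [C_11^1 = 1] and [C_yy^1 = e], for which [y] and [x1^2 + e y^2] are affine. *)
Lemma flat_oblique_affine C m e : (forall i j k, C i j k = C j i k) ->
  (forall k, C i2 i2 k = e * match k with i1 => 1 | i2 => m end) ->
  (forall k, C i1 i2 k = - m * e * match k with i1 => 1 | i2 => m end) ->
  (forall k, C i1 i1 k = (1 + m * m * e) * match k with i1 => 1 | i2 => m end) ->
  exists f g, affine_function C f /\ affine_function C g /\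
    forall x1 x2, 0 < x1 -> jacobian f g x1 x2 <> 0.
Proof.
  intros hsym H22 H12 H11.
  exists (fun u v => v - m * u), (fun u v => u * u + e * ((v - m * u) * (v - m * u))).
  assert (Pf : forall i u v, 0 < u -> partial i (fun u v => v - m * u) u v
     = match i with i1 => - m | i2 => 1 end).
  { intros i u v hu. partial_step. destruct i; ring. }
  assert (Pg : forall i u v, 0 < u ->
     partial i (fun u v => u * u + e * ((v - m * u) * (v - m * u))) u v
     = match i with i1 => 2 * u - 2 * e * m * (v - m * u)
                  | i2 => 2 * e * (v - m * u) end).
  { intros i u v hu. partial_step. destruct i; ring. }
  split; [|split].
  - split; [smooth_tac|]. intros x1 x2 h i j. unfold hessian, sum2.
    rewrite (partial_ext i _ (fun _ _ => match j with i1 => - m | i2 => 1 end)) by auto.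
    rewrite !Pf by auto. partial_step. unfold typeB.
    destruct i, j; rewrite ?(hsym i2 i1), ?H11, ?H12, ?H22; ring.
  - split; [smooth_tac|]. intros x1 x2 h i j. unfold hessian, sum2.
    rewrite (partial_ext i _ (fun u v => match j with
                  | i1 => 2 * u - 2 * e * m * (v - m * u)
                  | i2 => 2 * e * (v - m * u) end)) by auto.
    rewrite !Pg by auto. unfold typeB.
    destruct i, j; partial_step;
      rewrite ?(hsym i2 i1), ?H11, ?H12, ?H22; field; lra.
  - intros x1 x2 h. unfold jacobian. rewrite !Pf, !Pg by auto.
    match goal with |- ?a <> 0 => replace a with (-2 * x1) by ring end. lra.
Qed.

(** Let [A] and [B] be the matrices of [x1 nabla_{d_1}] and [x1 nabla_{d_2}].  Flatness
    means [A B - B A = B], so [B] is nilpotent.  Either its image lies in the span of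
    [d_2], which is the normal form, or it is spanned by some [d_1 + m d_2]. *)
Lemma flat_dim C n : (forall i j k, C i j k = C j i k) ->
  (forall i j, ric C i j = 0) ->
  dim_vf (affine_killing (typeB C)) n -> (5 <= n)%nat.
Proof.
  intros hsym F.
  cut (exists f g, affine_function C f /\ affine_function C g /\
         forall x1 x2, 0 < x1 -> jacobian f g x1 x2 <> 0).
  { intros [f [g [Hf [Hg N]]]]. now apply (affine_coordinates_dim C f g). }
  pose proof (F i1 i1) as F11. pose proof (F i1 i2) as F12.
  pose proof (F i2 i1) as F21. pose proof (F i2 i2) as F22.
  unfold ric, sum2 in F11, F12, F21, F22. rewrite !(hsym i2 i1) in *.
  remember (C i1 i1 i1) as a eqn:Ea. remember (C i1 i1 i2) as b eqn:Eb.
  remember (C i1 i2 i1) as c eqn:Ec. remember (C i1 i2 i2) as d eqn:Ed.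
  remember (C i2 i2 i1) as e eqn:Ee. remember (C i2 i2 i2) as f eqn:Ef.
  assert (R21 : c * d - e * b - c = 0) by lra.
  assert (R22 : a * e + c * f - c * c - e * d - e = 0) by lra.
  assert (R11 : b * c + d * d - d * a - f * b - d = 0) by lra.
  assert (R12 : b * e - d * c - f = 0) by lra.
  clear F11 F12 F21 F22.
  destruct (Req_dec e 0) as [Ze|Ne].
  - assert (c = 0 /\ f = 0) as [Zc Zf].
    { rewrite Ze in *. assert (Ef' : f = - (d * c)) by lra. rewrite Ef' in *.
      assert (Q : c * (d - 1) = 0) by lra. apply Rmult_integral in Q.
      destruct Q as [Q|Q]; [rewrite Q; split; ring|].
      assert (d = 1) as Hd by lra. rewrite Hd in *.
      assert (c * c = 0) as Q2 by lra. apply Rmult_integral in Q2. destruct Q2; lra. }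
    rewrite (Cnormal_eq C hsym) by congruence.
    rewrite <- Ea, <- Eb, <- Ed.
    apply flat_normal_affine. rewrite Zc, Zf in *. lra.
  - assert (Hf : f = - c) by lra.
    assert (Hd : e * d = - (c * c)).
    { rewrite Hf in *.
      (* multiply R11 by e and eliminate e b and a e *)
      assert (Q : e * (b * c + d * d - d * a - - c * b - d)
        = 2 * c * (b * e - d * c - - c) - d * (a * e + c * - c - c * c - e * d - e)
          + -2 * (c * c) - 2 * (e * d)) by ring.
      rewrite R11, R12, R22 in Q. lra. }
    assert (Ha : a * e = e + c * c) by (rewrite Hf in *; lra).
    assert (Hb : e * b = c * d - c) by lra.
    apply (flat_oblique_affine C (- c / e) e hsym); intros [|];
      rewrite <- ?Ea, <- ?Eb, <- ?Ec, <- ?Ed, <- ?Ee, <- ?Ef;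
      apply (Rmult_eq_reg_l e); auto.
    + ring.
    + rewrite Hf. field. auto.
    + field. auto.
    + rewrite Hd. field. auto.
    + rewrite (Rmult_comm e a), Ha. field. auto.
    + rewrite Hb. apply (Rmult_eq_reg_l e); auto.
      transitivity (c * (e * d) - c * e); [ring|]. rewrite Hd. field. auto.
Qed.

(** * Normal forms *)

Lemma is_partial_shear f a b i y1 y2 : smooth f -> b <> 0 -> 0 < y1 ->
  is_partial i (fun y1 y2 => f y1 ((y2 - a * y1) / b)) y1 y2
    match i with
    | i1 => partial i1 f y1 ((y2 - a * y1) / b)
            + partial i2 f y1 ((y2 - a * y1) / b) * - (a / b)
    | i2 => partial i2 f y1 ((y2 - a * y1) / b) * / b
    end.
Proof.
  intros S nb h.
  assert (D : differentiable_pt_lim f y1 ((y2 - a * y1) / b)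
     (partial i1 f y1 ((y2 - a * y1) / b)) (partial i2 f y1 ((y2 - a * y1) / b))).
  { apply filterdiff_differentiable_pt_lim.
    apply (is_derive_filterdiff f _ _ (partial i1 f)).
    - apply (locally_2d_locally
        (fun u v => is_derive (fun z => f z v) u (partial i1 f u v))). apply half_plane_open; auto.
      intros u v hu. now apply (smooth_is_partial i1).
    - now apply (smooth_is_partial i2).
    - apply continuity_2d_pt_filterlim. apply smooth_continuity; auto.
      now apply smooth_partial. }
  destruct i; simpl; apply is_derive_Reals.
  - replace (Derive (fun t => f t ((y2 - a * y1) / b)) y1) with
      (Derive (fun t => f t ((y2 - a * y1) / b)) y1 * 1) by ring.
    apply (derivable_pt_lim_comp_2d f (fun t => t) (fun t => (y2 - a * t) / b)); auto.
    + apply derivable_pt_lim_id.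
    + apply is_derive_Reals. auto_derive; auto. field. auto.
  - replace (Derive _ _ * / b) with
      (Derive (fun t => f t ((y2 - a * y1) / b)) y1 * 0
       + Derive (fun t => f y1 t) ((y2 - a * y1) / b) * / b) by ring.
    apply (derivable_pt_lim_comp_2d f (fun _ => y1) (fun t => (t - a * y1) / b)); auto.
    + apply derivable_pt_lim_const.
    + apply is_derive_Reals. auto_derive; auto. field. auto.
Qed.

(** The map is [(x1, x2) |-> (x1, a x1 + b x2)]. *)
Lemma linearly_isomorphic_Cnormal p q kappa a b : b <> 0 ->
  linearly_isomorphic (typeB (Cnormal p q kappa))
    (typeB (Cnormal p (b * q + a * (p - 2 * kappa)) kappa)).
Proof.
  intros nb. exists a, b. split; auto. intros X Y SX SY k y1 y2 h.
  pose proof (fun i => is_partial_unique i _ _ _ _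
    (is_partial_shear (Y i1) a b i y1 y2 (SY i1) nb h)
    : partial i (push a b Y i1) y1 y2 = _) as P1.
  pose proof (fun i => is_partial_unique i _ _ _ _
    (is_partial_plus i _ _ _ _ _ _
      (is_partial_mult i _ _ _ _ _ _ (is_partial_const i a y1 y2)
        (is_partial_shear (Y i1) a b i y1 y2 (SY i1) nb h))
      (is_partial_mult i _ _ _ _ _ _ (is_partial_const i b y1 y2)
        (is_partial_shear (Y i2) a b i y1 y2 (SY i2) nb h)))
    : partial i (push a b Y i2) y1 y2 = _) as P2.
  cbv beta in P1, P2.
  unfold cov, sum2.
  destruct k; rewrite ?P1, ?P2; unfold push, typeB, Cnormal; field; lra.
Qed.

Lemma Z1_Cnormal kappa : Z1 kappa = Cnormal (2 * kappa) 1 kappa.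
Proof. extensionality i. extensionality j. extensionality k. now destruct i, j, k. Qed.

Lemma Z2_Cnormal kappa theta : Z2 kappa theta = Cnormal (2 * kappa + theta - 1) 0 kappa.
Proof. extensionality i. extensionality j. extensionality k. now destruct i, j, k. Qed.

Lemma Z3_Cnormal kappa : Z3 kappa = Cnormal (2 * kappa - 1) 0 kappa.
Proof. extensionality i. extensionality j. extensionality k. now destruct i, j, k. Qed.

Lemma ricci_is_Cnormal p q kappa r : r = kappa * (p - kappa + 1) ->
  ricci_is (typeB (Cnormal p q kappa)) r.
Proof.
  intros -> x1 x2 h i j. rewrite ricci_typeB, ric_Cnormal by auto.
  destruct i, j; field; lra.
Qed.

(** * Linear equations of second order *)

Lemma constant_on_half_line (g : R -> R) :
  (forall x, 0 < x -> is_derive g x 0) -> forall x, 0 < x -> g x = g 1.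
Proof.
  intros D x h. destruct (Rtotal_order x 1) as [l|[->|l]]; auto.
  - apply (eq_is_derive g x 1); auto. intros; apply D; lra.
  - symmetry. apply (eq_is_derive g 1 x); auto. intros; apply D; lra.
Qed.

Definition ode2 (P Q y y' : R -> R) : Prop := forall x, 0 < x ->
  is_derive y x (y' x) /\ is_derive y' x (P x * y' x + Q x * y x).

Definition wronskian (y y' z z' : R -> R) (x : R) : R := y x * z' x - y' x * z x.

Lemma is_derive_wronskian P Q y y' z z' x : ode2 P Q y y' -> ode2 P Q z z' -> 0 < x ->
  is_derive (wronskian y y' z z') x (P x * wronskian y y' z z' x).
Proof.
  intros Hy Hz h. destruct (Hy x h) as [Y1 Y2]. destruct (Hz x h) as [Z1 Z2].
  unfold wronskian.
  replace (P x * (y x * z' x - y' x * z x)) with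
    ((y' x * z' x + y x * (P x * z' x + Q x * z x))
     - ((P x * y' x + Q x * y x) * z x + y' x * z' x)) by ring.
  apply (is_derive_minus (fun x => y x * z' x) (fun x => y' x * z x)).
  - apply (is_derive_mult y z'); auto. exact Rmult_comm.
  - apply (is_derive_mult y' z); auto. exact Rmult_comm.
Qed.

(** All Wronskians solve the same first-order equation, so their quotients are
    constant; Cramer's rule gives the coefficients as such quotients. *)
Lemma ode2_basis P Q u u' u1 u1' u2 u2' :
  ode2 P Q u u' -> ode2 P Q u1 u1' -> ode2 P Q u2 u2' ->
  (forall x, 0 < x -> wronskian u1 u1' u2 u2' x <> 0) ->
  exists c1 c2, forall x, 0 < x -> u x = c1 * u1 x + c2 * u2 x.
Proof.
  intros Hu H1 H2 N.
  assert (K : forall y y' z z', ode2 P Q y y' -> ode2 P Q z z' -> forall x, 0 < x ->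
    wronskian y y' z z' x / wronskian u1 u1' u2 u2' x
    = wronskian y y' z z' 1 / wronskian u1 u1' u2 u2' 1).
  { intros y y' z z' Hy Hz.
    apply (constant_on_half_line
      (fun x => wronskian y y' z z' x / wronskian u1 u1' u2 u2' x)).
    intros x h.
    replace 0 with ((P x * wronskian y y' z z' x * wronskian u1 u1' u2 u2' x
       - wronskian y y' z z' x * (P x * wronskian u1 u1' u2 u2' x))
       / wronskian u1 u1' u2 u2' x ^ 2) by (unfold Rdiv; ring).
    apply is_derive_div; auto; now apply (is_derive_wronskian P Q). }
  exists (wronskian u u' u2 u2' 1 / wronskian u1 u1' u2 u2' 1),
    (wronskian u1 u1' u u' 1 / wronskian u1 u1' u2 u2' 1).
  intros x h. rewrite <- (K u u' u2 u2' Hu H2 x h), <- (K u1 u1' u u' H1 Hu x h).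
  specialize (N x h). unfold wronskian in *. field. auto.
Qed.

Lemma is_derive_Rpower_mult a (g : R -> R) g' x : 0 < x -> is_derive g x g' ->
  is_derive (fun x => Rpower x a * g x) x (Rpower x a * (a * / x * g x + g')).
Proof.
  intros h D.
  replace (Rpower x a * (a * / x * g x + g')) with
    (a * / x * Rpower x a * g x + Rpower x a * g') by ring.
  apply (is_derive_mult (fun x => Rpower x a) g); auto; [|exact Rmult_comm].
  now apply is_derive_Rpower.
Qed.

(** The second factor of [(x^a g)' = x^a (a g / x + g')], needed for [(x^a g)'']. *)
Lemma is_derive_log_factor a (g g' : R -> R) g'' x :
  0 < x -> is_derive g x (g' x) -> is_derive g' x g'' ->
  is_derive (fun x => a * / x * g x + g' x) x
    (- (a * / x * / x) * g x + a * / x * g' x + g'').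
Proof.
  intros h D D'.
  apply (is_derive_plus (fun x => a * / x * g x) g'); auto.
  apply (is_derive_mult (fun x => a * / x) g); auto; [|exact Rmult_comm].
  auto_derive; [lra|]. field. lra.
Qed.

(** Euler's equation [y'' = (p / x) y' + (m / x^2) y] after the substitution
    [y = x^a g]. *)
Lemma euler_ode2 p m a (g g' g'' : R -> R) :
  (forall x, 0 < x -> is_derive g x (g' x) /\ is_derive g' x (g'' x) /\
     x ^ 2 * g'' x + (2 * a - p) * (x * g' x) + (a * a - (p + 1) * a - m) * g x = 0) ->
  ode2 (fun x => p * / x) (fun x => m * / x * / x)
    (fun x => Rpower x a * g x) (fun x => Rpower x a * (a * / x * g x + g' x)).
Proof.
  intros H x h. destruct (H x h) as [D [D' E]]. split.
  - now apply is_derive_Rpower_mult.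
  - replace (p * / x * (Rpower x a * (a * / x * g x + g' x))
             + m * / x * / x * (Rpower x a * g x))
      with (Rpower x a * (a * / x * (a * / x * g x + g' x)
         + (- (a * / x * / x) * g x + a * / x * g' x + g'' x))).
    + apply (is_derive_Rpower_mult a (fun x => a * / x * g x + g' x)); auto.
      now apply is_derive_log_factor.
    + apply Rminus_diag_uniq.
      transitivity (Rpower x a * / x * / x * (x ^ 2 * g'' x + (2 * a - p) * (x * g' x)
        + (a * a - (p + 1) * a - m) * g x)); [field; lra|]. rewrite E. ring.
Qed.

(** * The solution spaces *)

Lemma ricci_sym_Cnormal p q kappa i j x1 x2 : 0 < x1 ->
  ricci_sym (typeB (Cnormal p q kappa)) (coord_vf i) (coord_vf j) x1 x2 =
  / x1 * / x1 * match i, j with i1, i1 => kappa * (p - kappa + 1) | _, _ => 0 end.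
Proof.
  intros h. unfold ricci_sym. rewrite !ricci_typeB, !ric_Cnormal by auto.
  destruct i, j; field; lra.
Qed.

Lemma E_ext mu G f g : (forall x1 x2, 0 < x1 -> f x1 x2 = g x1 x2) ->
  E mu G f -> E mu G g.
Proof.
  intros H [S Hf]. split; [now apply (smooth_ext f)|].
  intros x1 x2 h i j. rewrite <- H, <- Hf by auto. unfold hessian, sum2.
  rewrite <- !(partial_ext _ _ _ _ _ h H). f_equal. symmetry.
  apply partial_ext; auto. intros; now apply partial_ext.
Qed.

Section Solutions.

Variables p q kappa mu : R.
Let r := kappa * (p - kappa + 1).
Let N := typeB (Cnormal p q kappa).
Let P := fun x : R => p * / x.
Let Q := fun x : R => mu * r * / x * / x.

Lemma E_intro (A A' : R -> R) b :
  smooth (fun x _ => A x) ->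
  (forall x, 0 < x -> is_derive A x (A' x) /\
     is_derive A' x (P x * A' x + Q x * A x + q * / x * (b * Rpower x kappa))) ->
  b * (r * (1 + mu)) = 0 ->
  E mu N (affine_in_x2 A (fun x => b * Rpower x kappa)).
Proof.
  intros SA DA Z. split; [apply smooth_affine_in_x2; auto; smooth_tac|].
  intros x1 x2 h i j. unfold N.
  rewrite (hessian_affine_in_x2 _ A A'
    (fun x => P x * A' x + Q x * A x + q * / x * (b * Rpower x kappa))
    (fun x => b * Rpower x kappa) (fun x => b * (kappa * / x * Rpower x kappa))
    (fun x => b * (kappa * (kappa - 1) * / x * / x * Rpower x kappa))); auto;
    try (intros; now apply DA).
  - rewrite ricci_sym_Cnormal by auto. unfold affine_in_x2.
    destruct i, j; unfold Cnormal, P, Q; try ring.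
    apply Rminus_diag_uniq.
    transitivity (- (/ x1 * / x1 * Rpower x1 kappa * x2 * (b * (r * (1 + mu)))));
      [unfold r; ring|]. rewrite Z. ring.
  - intros x hx. apply is_derive_scal. now apply is_derive_Rpower.
  - intros x hx. apply is_derive_scal.
    replace (kappa * (kappa - 1) * / x * / x * Rpower x kappa)
      with (kappa * (- / x ^ 2) * Rpower x kappa
            + kappa * / x * (kappa * / x * Rpower x kappa)) by (field; lra).
    apply (is_derive_mult (fun x => kappa * / x) (fun x => Rpower x kappa));
      [|now apply is_derive_Rpower|exact Rmult_comm].
    auto_derive; [lra|]. field. lra.
Qed.

(** The components [22] and [12] of the equation force [f = A + b x2 x1^kappa]; the part
    of the component [11] that is linear in [x2] reads [b r (1 + mu) = 0], which is why
    [mu = -1] is exceptional. *)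
Lemma E_shape f : E mu N f -> exists (A A' : R -> R) (b : R),
  (forall x1 x2, 0 < x1 -> f x1 x2 = affine_in_x2 A (fun x => b * Rpower x kappa) x1 x2) /\
  (forall x, 0 < x -> is_derive A x (A' x) /\
     is_derive A' x (P x * A' x + Q x * A x + q * / x * (b * Rpower x kappa))) /\
  b * (r * (1 + mu)) = 0.
Proof.
  intros [S H].
  assert (H' : forall i j x1 x2, 0 < x1 -> partial i (partial j f) x1 x2 =
    / x1 * (Cnormal p q kappa i j i1 * partial i1 f x1 x2
            + Cnormal p q kappa i j i2 * partial i2 f x1 x2)
    + mu * f x1 x2 * (/ x1 * / x1 * match i, j with i1, i1 => r | _, _ => 0 end)).
  { intros i j x1 x2 h. unfold r. rewrite <- (ricci_sym_Cnormal p q kappa i j x1 x2 h).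
    fold N. rewrite <- (H x1 x2 h i j). unfold hessian, sum2, N, typeB. ring. }
  assert (Const2 : forall g : R -> R, (forall t, is_derive g t 0) ->
    forall t, g t = g 0).
  { intros g D t. destruct (Rtotal_order t 0) as [l|[->|l]]; auto.
    - apply (eq_is_derive g t 0); auto.
    - symmetry. apply (eq_is_derive g 0 t); auto. }
  assert (F2 : forall x1 x2, 0 < x1 -> partial i2 f x1 x2 = partial i2 f x1 0).
  { intros x1 x2 h. apply (Const2 (fun t => partial i2 f x1 t)). intros t.
    pose proof (smooth_is_partial i2 _ x1 t (smooth_partial i2 f S) h) as D.
    rewrite H' in D by auto. unfold Cnormal in D.
    replace (_ + _) with 0 in D by ring. exact D. }
  set (B := fun x => partial i2 f x 0).
  assert (F : forall x1 x2, 0 < x1 -> f x1 x2 = f x1 0 + x2 * B x1).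
  { intros x1 x2 h.
    pose proof (Const2 (fun t => f x1 t - t * B x1)) as K. simpl in K.
    rewrite <- (Rplus_0_r (f x1 0)). replace 0 with (- (0 * B x1)) at 2 by ring.
    enough (f x1 x2 - x2 * B x1 = f x1 0 - 0 * B x1) by lra.
    apply K. intros t. pose proof (smooth_is_partial i2 f x1 t S h) as D.
    rewrite F2 in D by auto. change (is_derive (fun t => f x1 t) t (B x1)) in D.
    replace 0 with (B x1 - 1 * B x1) by ring.
    apply (is_derive_minus (fun t => f x1 t) (fun t => t * B x1)); auto.
    auto_derive; auto. }
  assert (DB : forall x, 0 < x -> is_derive B x (kappa * / x * B x)).
  { intros x h. pose proof (smooth_is_partial i1 _ x 0 (smooth_partial i2 f S) h) as D.
    rewrite H' in D by auto. unfold Cnormal in D.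
    replace (kappa * / x * B x) with (/ x * (0 * partial i1 f x 0 + kappa * partial i2 f x 0)
      + mu * f x 0 * (/ x * / x * 0)) by (unfold B; ring). exact D. }
  assert (EB : forall x, 0 < x -> B x = B 1 * Rpower x kappa).
  { intros x h.
    pose proof (constant_on_half_line (fun x => Rpower x (- kappa) * B x)) as K.
    simpl in K. assert (Rpower x (- kappa) * B x = B 1).
    { rewrite K; auto.
      - unfold Rpower. rewrite ln_1, Rmult_0_r, exp_0. ring.
      - intros y hy. replace 0 with
          (Rpower y (- kappa) * (- kappa * / y * B y + kappa * / y * B y)) by ring.
        apply is_derive_Rpower_mult; auto. }
    rewrite <- H0, Rpower_Ropp. field. apply Rpower_ne_0. }
  set (b := B 1) in *.
  set (A := fun x => f x 0). set (A' := fun x => partial i1 f x 0).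
  set (A2 := fun x => partial i1 (partial i1 f) x 0).
  assert (DA : forall x, 0 < x -> is_derive A x (A' x))
    by (intros x h; apply (smooth_is_partial i1 f x 0 S h)).
  assert (DA' : forall x, 0 < x -> is_derive A' x (A2 x))
    by (intros x h; apply (smooth_is_partial i1 _ x 0 (smooth_partial i1 f S) h)).
  assert (Ef : forall x1 x2, 0 < x1 ->
    f x1 x2 = affine_in_x2 A (fun x => b * Rpower x kappa) x1 x2).
  { intros x1 x2 h. unfold affine_in_x2, A. rewrite <- EB; auto. }
  assert (EA : forall x, 0 < x ->
    A2 x = P x * A' x + Q x * A x + q * / x * (b * Rpower x kappa)).
  { intros x h. unfold A2. rewrite H' by auto. unfold Cnormal.
    rewrite <- EB by auto. unfold P, Q, A, A', B. ring. }
  exists A, A', b. split; [exact Ef|split].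
  - intros x h. split; auto. rewrite <- EA by auto. now apply DA'.
  - (* compare the component 11 at (1, 0) and at (1, 1) *)
    assert (h1 : 0 < 1) by lra.
    destruct (E_ext mu N f _ Ef (conj S H)) as [_ G]. specialize (G 1 1 h1 i1 i1).
    unfold N in G.
    rewrite (hessian_affine_in_x2 _ A A' A2
      (fun x => b * Rpower x kappa) (fun x => b * (kappa * / x * Rpower x kappa))
      (fun x => b * (kappa * (kappa - 1) * / x * / x * Rpower x kappa))) in G; auto.
    + rewrite ricci_sym_Cnormal, EA in G by auto. unfold affine_in_x2, Cnormal in G.
      assert (R1 : Rpower 1 kappa = 1)
        by (unfold Rpower; rewrite ln_1, Rmult_0_r; apply exp_0).
      unfold P, Q, r in *. rewrite R1, Rinv_1 in G. lra.
    + intros x hx. apply is_derive_scal. now apply is_derive_Rpower.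
    + intros x hx. apply is_derive_scal.
      replace (kappa * (kappa - 1) * / x * / x * Rpower x kappa)
        with (kappa * (- / x ^ 2) * Rpower x kappa
              + kappa * / x * (kappa * / x * Rpower x kappa)) by (field; lra).
      apply (is_derive_mult (fun x => kappa * / x) (fun x => Rpower x kappa));
        [|now apply is_derive_Rpower|exact Rmult_comm].
      auto_derive; [lra|]. field. lra.
Qed.

(** If [r (1 + mu) = 0], the function [h + x2 x1^kappa] is a solution that depends on [x2].
    Otherwise [b] has to vanish and [h] is arbitrary. *)
Lemma E_general (u1 u1' u2 u2' h h' : R -> R) f :
  smooth (fun x _ => u1 x) -> smooth (fun x _ => u2 x) -> smooth (fun x _ => h x) ->
  ode2 P Q u1 u1' -> ode2 P Q u2 u2' ->
  (forall x, 0 < x -> wronskian u1 u1' u2 u2' x <> 0) ->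
  (r * (1 + mu) = 0 -> forall x, 0 < x -> is_derive h x (h' x) /\
     is_derive h' x (P x * h' x + Q x * h x + q * / x * Rpower x kappa)) ->
  (E mu N f <-> exists c1 c2 b, b * (r * (1 + mu)) = 0 /\
     forall x1 x2, 0 < x1 ->
       f x1 x2 = c1 * u1 x1 + c2 * u2 x1 + b * (h x1 + x2 * Rpower x1 kappa)).
Proof.
  intros S1 S2 Sh H1 H2 W Hh.
  assert (Hb : forall b, b * (r * (1 + mu)) = 0 -> forall x, 0 < x ->
    is_derive (fun x => b * h x) x (b * h' x) /\
    is_derive (fun x => b * h' x) x
      (b * (P x * h' x + Q x * h x + q * / x * Rpower x kappa))).
  { intros b Z x hx. destruct (Rmult_integral _ _ Z) as [->|Z'].
    - split; rewrite Rmult_0_l; apply (is_derive_ext (fun _ => 0));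
        [intros t; symmetry; apply Rmult_0_l|exact (is_derive_const _ _)
        |intros t; symmetry; apply Rmult_0_l|exact (is_derive_const _ _)].
    - split; apply is_derive_scal; now apply Hh. }
  split.
  - intros Ef. destruct (E_shape f Ef) as [A [A' [b [F [DA Z]]]]].
    destruct (ode2_basis P Q (fun x => A x - b * h x) (fun x => A' x - b * h' x)
                u1 u1' u2 u2') as [c1 [c2 K]]; auto.
    { intros x hx. destruct (DA x hx) as [D1 D2]. destruct (Hb b Z x hx) as [D3 D4]. split.
      - now apply (is_derive_minus A (fun x => b * h x)).
      - replace (P x * (A' x - b * h' x) + Q x * (A x - b * h x)) with
          ((P x * A' x + Q x * A x + q * / x * (b * Rpower x kappa))
           - b * (P x * h' x + Q x * h x + q * / x * Rpower x kappa)) by ring.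
        now apply (is_derive_minus A' (fun x => b * h' x)). }
    exists c1, c2, b. split; auto. intros x1 x2 hx. rewrite F by auto.
    rewrite <- K by auto. unfold affine_in_x2. ring.
  - intros [c1 [c2 [b [Z F]]]].
    apply (E_ext mu N (affine_in_x2 (fun x => c1 * u1 x + c2 * u2 x + b * h x)
             (fun x => b * Rpower x kappa))).
    { intros x1 x2 hx. rewrite F by auto. unfold affine_in_x2. ring. }
    apply (E_intro _ (fun x => c1 * u1' x + c2 * u2' x + b * h' x)); auto.
    { smooth_tac. }
    intros x hx. destruct (H1 x hx) as [D1 D1']. destruct (H2 x hx) as [D2 D2'].
    destruct (Hb b Z x hx) as [D3 D3']. split.
    + apply (is_derive_plus (fun x => c1 * u1 x + c2 * u2 x) (fun x => b * h x)).
      * apply (is_derive_plus (fun x => c1 * u1 x) (fun x => c2 * u2 x));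
          now apply is_derive_scal.
      * assumption.
    + match goal with |- is_derive _ _ ?d => replace d with
        (c1 * (P x * u1' x + Q x * u1 x) + c2 * (P x * u2' x + Q x * u2 x)
         + b * (P x * h' x + Q x * h x + q * / x * Rpower x kappa)) by ring end.
      apply (is_derive_plus (fun x => c1 * u1' x + c2 * u2' x) (fun x => b * h' x)).
      * apply (is_derive_plus (fun x => c1 * u1' x) (fun x => c2 * u2' x));
          now apply is_derive_scal.
      * assumption.
Qed.

End Solutions.

Lemma span2 g1 g2 f : span [g1; g2] f <->
  exists c1 c2, forall x1 x2, 0 < x1 -> f x1 x2 = c1 * g1 x1 x2 + c2 * g2 x1 x2.
Proof.
  split.
  - intros [c [L F]]. destruct c as [|c1 [|c2 [|]]]; try discriminate L.
    exists c1, c2. intros x1 x2 h. rewrite F by auto. simpl. ring.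
  - intros [c1 [c2 F]]. exists [c1; c2]. split; auto. intros x1 x2 h.
    rewrite F by auto. simpl. ring.
Qed.

Lemma span3 g1 g2 g3 f : span [g1; g2; g3] f <->
  exists c1 c2 c3, forall x1 x2, 0 < x1 ->
    f x1 x2 = c1 * g1 x1 x2 + c2 * g2 x1 x2 + c3 * g3 x1 x2.
Proof.
  split.
  - intros [c [L F]]. destruct c as [|c1 [|c2 [|c3 [|]]]]; try discriminate L.
    exists c1, c2, c3. intros x1 x2 h. rewrite F by auto. simpl. ring.
  - intros [c1 [c2 [c3 F]]]. exists [c1; c2; c3]. split; auto. intros x1 x2 h.
    rewrite F by auto. simpl. ring.
Qed.

Lemma wronskian_Rpower a b (g g' h h' : R -> R) x : 0 < x ->
  wronskian (fun x => Rpower x a * g x) (fun x => Rpower x a * (a * / x * g x + g' x))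
    (fun x => Rpower x b * h x) (fun x => Rpower x b * (b * / x * h x + h' x)) x
  = Rpower x a * Rpower x b * ((b - a) * / x * (g x * h x) + (g x * h' x - g' x * h x)).
Proof. intros hx. unfold wronskian. ring. Qed.

Section PowerSolutions.

Variables p q kappa mu : R.
Let r := kappa * (p - kappa + 1).
Let N := typeB (Cnormal p q kappa).
Hypothesis hr : r <> 0.
Hypothesis hmu : mu <> -1.

Lemma E_two_powers a b (g1 g1' g1'' g2 g2' g2'' : R -> R) :
  smooth (fun x _ => g1 x) -> smooth (fun x _ => g2 x) ->
  (forall x, 0 < x -> is_derive g1 x (g1' x) /\ is_derive g1' x (g1'' x) /\
     x ^ 2 * g1'' x + (2 * a - p) * (x * g1' x)
     + (a * a - (p + 1) * a - mu * r) * g1 x = 0) ->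
  (forall x, 0 < x -> is_derive g2 x (g2' x) /\ is_derive g2' x (g2'' x) /\
     x ^ 2 * g2'' x + (2 * b - p) * (x * g2' x)
     + (b * b - (p + 1) * b - mu * r) * g2 x = 0) ->
  (forall x, 0 < x ->
     (b - a) * / x * (g1 x * g2 x) + (g1 x * g2' x - g1' x * g2 x) <> 0) ->
  forall f, E mu N f <-> exists c1 c2, forall x1 x2, 0 < x1 ->
    f x1 x2 = c1 * (Rpower x1 a * g1 x1) + c2 * (Rpower x1 b * g2 x1).
Proof.
  intros S1 S2 D1 D2 W f. unfold N.
  rewrite (E_general p q kappa mu
    (fun x => Rpower x a * g1 x) (fun x => Rpower x a * (a * / x * g1 x + g1' x))
    (fun x => Rpower x b * g2 x) (fun x => Rpower x b * (b * / x * g2 x + g2' x))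
    (fun _ => 0) (fun _ => 0)).
  - split.
    + intros [c1 [c2 [c3 [Z F]]]]. exists c1, c2. intros x1 x2 h.
      assert (c3 = 0) as Z3.
      { destruct (Rmult_integral _ _ Z) as [|Z']; auto. exfalso.
        destruct (Rmult_integral _ _ Z'); [now apply hr|apply hmu; lra]. }
      rewrite F, Z3 by auto. ring.
    + intros [c1 [c2 F]]. exists c1, c2, 0. split; [ring|]. intros x1 x2 h.
      rewrite F by auto. ring.
  - smooth_tac.
  - smooth_tac.
  - smooth_tac.
  - now apply (euler_ode2 p (mu * r) a g1 g1' g1'').
  - now apply (euler_ode2 p (mu * r) b g2 g2' g2'').
  - intros x h. rewrite wronskian_Rpower by auto.
    repeat apply Rmult_integral_contrapositive_currified;
      auto using Rpower_ne_0.
  - intros Z. exfalso.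
    destruct (Rmult_integral _ _ Z); [now apply hr|apply hmu; lra].
Qed.

(** [s + sqrt d] and [s - sqrt d] are the roots of the indicial polynomial
    [a^2 - (p + 1) a - mu r] of Euler's equation. *)
Lemma E_spanned_by_powers s d : 2 * s = p + 1 -> d = s * s + mu * r -> d <> 0 ->
  spanned_by_powers (E mu N) (RtoC s + csqrt d)%C (RtoC s - csqrt d)%C.
Proof.
  intros Hs Hd nd. unfold csqrt. destruct (Rle_dec 0 d) as [h|h].
  - assert (dpos : 0 < d) by lra. pose proof (sqrt_lt_R0 d dpos) as ht.
    pose proof (sqrt_sqrt d h) as tt. set (t := sqrt d) in *.
    split; [intros _|intros [K|K]; exfalso; apply K; simpl; ring].
    intros f. rewrite span2.
    rewrite (E_two_powers (s + t) (s - t) (fun _ => 1) (fun _ => 0) (fun _ => 0)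
               (fun _ => 1) (fun _ => 0) (fun _ => 0)).
    + split; intros [c1 [c2 F]]; exists c1, c2; intros x1 x2 hx; rewrite F by auto;
        simpl; unfold Rminus; ring.
    + smooth_tac.
    + smooth_tac.
    + intros x hx. split; [|split]; try exact (is_derive_const _ _).
      replace (mu * r) with (t * t - s * s) by lra. replace (p + 1) with (2 * s) by lra.
      ring.
    + intros x hx. split; [|split]; try exact (is_derive_const _ _).
      replace (mu * r) with (t * t - s * s) by lra. replace (p + 1) with (2 * s) by lra.
      ring.
    + intros x hx. replace (_ + _) with (-2 * t * / x) by ring.
      pose proof (Rinv_0_lt_compat x hx).
      repeat apply Rmult_integral_contrapositive_currified; lra.
  - assert (dneg : 0 < - d) by lra. pose proof (sqrt_lt_R0 (- d) dneg) as hw.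
    pose proof (sqrt_sqrt (- d) (Rlt_le _ _ dneg)) as ww. set (w := sqrt (- d)) in *.
    split; [intros [K _]; exfalso; simpl in K; lra|]. intros _.
    pose (g1 := fun x => cos (w * ln x)). pose (g2 := fun x => sin (w * ln x)).
    assert (HE : forall f, E mu N f <-> exists c1 c2, forall x1 x2, 0 < x1 ->
      f x1 x2 = c1 * (Rpower x1 s * g1 x1) + c2 * (Rpower x1 s * g2 x1)).
    { apply (E_two_powers s s g1 (fun x => - (w * / x) * g2 x)
        (fun x => w * / x * / x * g2 x - w * w * / x * / x * g1 x)
        g2 (fun x => w * / x * g1 x)
        (fun x => - (w * / x * / x) * g1 x - w * w * / x * / x * g2 x)).
      - apply (smooth_ext (fun x _ => power_trig 0 w 1 0 x)); [|smooth_tac].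
        intros x _ hx. unfold power_trig. rewrite Rpower_O by auto. unfold g1. ring.
      - apply (smooth_ext (fun x _ => power_trig 0 w 0 1 x)); [|smooth_tac].
        intros x _ hx. unfold power_trig. rewrite Rpower_O by auto. unfold g2. ring.
      - intros x hx. split; [|split].
        + unfold g1, g2. auto_derive; auto. ring.
        + unfold g1, g2. auto_derive; [repeat split; auto; lra|]. field. lra.
        + replace (mu * r) with (- (w * w) - s * s) by lra.
          replace p with (2 * s - 1) by lra. field. lra.
      - intros x hx. split; [|split].
        + unfold g1, g2. auto_derive; auto. ring.
        + unfold g1, g2. auto_derive; [repeat split; auto; lra|]. field. lra.
        + replace (mu * r) with (- (w * w) - s * s) by lra.
          replace p with (2 * s - 1) by lra. field. lra.
      - intros x hx.
        pose proof (sin2_cos2 (w * ln x)) as SC. unfold Rsqr in SC.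
        replace (_ + _) with (w * / x * (sin (w * ln x) * sin (w * ln x)
          + cos (w * ln x) * cos (w * ln x))) by (unfold g1, g2; ring).
        rewrite SC. pose proof (Rinv_0_lt_compat x hx).
        repeat apply Rmult_integral_contrapositive_currified; lra. }
    assert (Pp : forall x, cpower x (RtoC s + Ci * RtoC w)%C
                           = (Rpower x s * g1 x, Rpower x s * g2 x)).
    { intros x. unfold cpower, cexp, Rpower, g1, g2. simpl.
      f_equal; f_equal; f_equal; ring. }
    assert (Pm : forall x, cpower x (RtoC s - Ci * RtoC w)%C
                           = (Rpower x s * g1 x, - (Rpower x s * g2 x))).
    { intros x. unfold cpower, cexp, Rpower, g1, g2. simpl.
      rewrite Ropp_mult_distr_r, <- sin_neg, <- (cos_neg (w * ln x)).
      f_equal; f_equal; f_equal; ring. }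
    (* z^(s + i w), z^(s - i w) are the combinations u1 + i u2, u1 - i u2
       of the real and imaginary part *)
    intros f. unfold complexify. rewrite !HE. split.
    + intros [[c1 [c2 F]] [e1 [e2 G]]].
      exists [((c1 + e2) / 2, (e1 - c2) / 2); ((c1 - e2) / 2, (e1 + c2) / 2)].
      split; auto. intros x1 x2 hx. simpl. rewrite Pp, Pm.
      rewrite (surjective_pairing (f x1 x2)).
      change (fst (f x1 x2)) with (Re (f x1 x2)).
      change (snd (f x1 x2)) with (Im (f x1 x2)).
      rewrite F, G by auto. unfold Cplus, Cmult, RtoC. simpl. f_equal; field.
    + intros [c [L F]]. destruct c as [|[a b] [|[c d'] [|]]]; try discriminate L.
      simpl in F. split.
      * exists (a + c), (d' - b). intros x1 x2 hx. rewrite F, Pp, Pm by auto.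
        simpl. ring.
      * exists (b + d'), (a - c). intros x1 x2 hx. rewrite F, Pp, Pm by auto.
        simpl. ring.
Qed.

Lemma E_double_root s : 2 * s = p + 1 -> s * s + mu * r = 0 ->
  same_space (E mu N)
    (times_span (fun x1 _ => Rpower x1 s) [fun _ _ => 1; fun x1 _ => ln x1]).
Proof.
  intros Hs Z f. unfold times_span. simpl map. rewrite span2.
  apply (E_two_powers s s (fun _ => 1) (fun _ => 0) (fun _ => 0)
           ln (fun x => / x) (fun x => - (/ x * / x))).
  - smooth_tac.
  - smooth_tac.
  - intros x hx. split; [|split]; try exact (is_derive_const _ _).
    replace (mu * r) with (- (s * s)) by lra. replace (p + 1) with (2 * s) by lra. ring.
  - intros x hx. split; [|split].
    + now apply is_derive_ln.
    + auto_derive; [lra|]. field. lra.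
    + replace (mu * r) with (- (s * s)) by lra. replace p with (2 * s - 1) by lra.
      field. lra.
  - intros x hx. pose proof (Rinv_0_lt_compat x hx). lra.
Qed.

End PowerSolutions.

(** For [mu = -1], [x1^kappa] is a solution; reduction of order leaves a first-order
    equation for the derivatives of the other factors. *)
Lemma E_exceptional p q kappa (g g' g'' k k' k'' : R -> R) :
  smooth (fun x _ => g x) -> smooth (fun x _ => k x) ->
  (forall x, 0 < x -> is_derive g x (g' x) /\ is_derive g' x (g'' x) /\ g' x <> 0 /\
     x * g'' x + (2 * kappa - p) * g' x = 0) ->
  (forall x, 0 < x -> is_derive k x (k' x) /\ is_derive k' x (k'' x) /\
     x * k'' x + (2 * kappa - p) * k' x = q) ->
  forall f, E (-1) (typeB (Cnormal p q kappa)) f <->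
    exists c1 c2 c3, forall x1 x2, 0 < x1 ->
    f x1 x2 = c1 * (Rpower x1 kappa * 1) + c2 * (Rpower x1 kappa * g x1)
              + c3 * (Rpower x1 kappa * (x2 + k x1)).
Proof.
  intros Sg Sk Dg Dk f. set (r := kappa * (p - kappa + 1)).
  rewrite (E_general p q kappa (-1)
    (fun x => Rpower x kappa * 1) (fun x => Rpower x kappa * (kappa * / x * 1 + 0))
    (fun x => Rpower x kappa * g x)
    (fun x => Rpower x kappa * (kappa * / x * g x + g' x))
    (fun x => Rpower x kappa * k x)
    (fun x => Rpower x kappa * (kappa * / x * k x + k' x))).
  - split.
    + intros [c1 [c2 [c3 [_ F]]]]. exists c1, c2, c3. intros x1 x2 h.
      rewrite F by auto. ring.
    + intros [c1 [c2 [c3 F]]]. exists c1, c2, c3. split; [ring|]. intros x1 x2 h.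
      rewrite F by auto. ring.
  - smooth_tac.
  - smooth_tac.
  - smooth_tac.
  - apply (euler_ode2 p (-1 * r) kappa (fun _ => 1) (fun _ => 0) (fun _ => 0)).
    intros x hx. split; [|split]; try exact (is_derive_const _ _). unfold r. ring.
  - apply (euler_ode2 p (-1 * r) kappa g g' g''). intros x hx.
    destruct (Dg x hx) as [D [D' [_ Z]]]. split; [|split]; auto.
    transitivity (x * (x * g'' x + (2 * kappa - p) * g' x)); [unfold r; ring|].
    rewrite Z. ring.
  - intros x hx. destruct (Dg x hx) as [_ [_ [N _]]].
    rewrite (wronskian_Rpower kappa kappa (fun _ => 1) (fun _ => 0)) by auto.
    replace (_ + _) with (g' x) by ring.
    repeat apply Rmult_integral_contrapositive_currified; auto using Rpower_ne_0.
  - intros _ x hx. destruct (Dk x hx) as [D [D' Z]]. split.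
    + now apply is_derive_Rpower_mult.
    + match goal with |- is_derive _ _ ?d => replace d with
        (Rpower x kappa * (kappa * / x * (kappa * / x * k x + k' x)
         + (- (kappa * / x * / x) * k x + kappa * / x * k' x + k'' x))) end.
      * apply (is_derive_Rpower_mult kappa (fun x => kappa * / x * k x + k' x)); auto.
        now apply is_derive_log_factor.
      * rewrite <- Z. unfold r. field. lra.
Qed.

Lemma Z1_exceptional kappa : same_space (E (-1) (typeB (Z1 kappa)))
  (times_span (fun x1 _ => Rpower x1 kappa)
     [fun _ _ => 1; fun x1 _ => x1; fun x1 x2 => x2 + x1 * ln x1]).
Proof.
  intros f. unfold times_span. simpl map. rewrite span3, Z1_Cnormal.
  apply (E_exceptional (2 * kappa) 1 kappa (fun x => x) (fun _ => 1) (fun _ => 0)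
    (fun x => x * ln x) (fun x => ln x + 1) (fun x => / x)).
  - smooth_tac.
  - smooth_tac.
  - intros x hx. split; [exact (is_derive_id x)|]. split; [exact (is_derive_const _ _)|].
    split; [lra|ring].
  - intros x hx. split; [|split].
    + auto_derive; auto. field. lra.
    + auto_derive; auto. ring.
    + field. lra.
Qed.

Lemma Z2_exceptional kappa theta : theta <> 0 ->
  same_space (E (-1) (typeB (Z2 kappa theta)))
  (times_span (fun x1 _ => Rpower x1 kappa)
     [fun _ _ => 1; fun _ x2 => x2; fun x1 _ => Rpower x1 theta]).
Proof.
  intros nt f. unfold times_span. simpl map. rewrite span3, Z2_Cnormal.
  rewrite (E_exceptional (2 * kappa + theta - 1) 0 kappa
    (fun x => Rpower x theta) (fun x => theta * / x * Rpower x theta)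
    (fun x => theta * (- / x ^ 2) * Rpower x theta
              + theta * / x * (theta * / x * Rpower x theta))
    (fun _ => 0) (fun _ => 0) (fun _ => 0)).
  - split; intros [c1 [c2 [c3 F]]]; exists c1, c3, c2; intros x1 x2 h;
      rewrite F by auto; ring.
  - smooth_tac.
  - smooth_tac.
  - intros x hx. split; [now apply is_derive_Rpower|]. split; [|split].
    + apply (is_derive_mult (fun x => theta * / x) (fun x => Rpower x theta));
        [|now apply is_derive_Rpower|exact Rmult_comm].
      auto_derive; [lra|]. field. lra.
    + repeat apply Rmult_integral_contrapositive_currified; auto using Rpower_ne_0.
      apply Rinv_neq_0_compat. lra.
    + field. lra.
  - intros x hx. split; [exact (is_derive_const _ _)|].
    split; [exact (is_derive_const _ _)|ring].
Qed.

Lemma Z3_exceptional kappa : same_space (E (-1) (typeB (Z3 kappa)))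
  (times_span (fun x1 _ => Rpower x1 kappa)
     [fun _ _ => 1; fun _ x2 => x2; fun x1 _ => ln x1]).
Proof.
  intros f. unfold times_span. simpl map. rewrite span3, Z3_Cnormal.
  rewrite (E_exceptional (2 * kappa - 1) 0 kappa
    ln (fun x => / x) (fun x => - (/ x * / x)) (fun _ => 0) (fun _ => 0) (fun _ => 0)).
  - split; intros [c1 [c2 [c3 F]]]; exists c1, c3, c2; intros x1 x2 h;
      rewrite F by auto; ring.
  - smooth_tac.
  - smooth_tac.
  - intros x hx. split; [now apply is_derive_ln|]. split; [|split].
    + auto_derive; [lra|]. field. lra.
    + apply Rinv_neq_0_compat. lra.
    + field. lra.
  - intros x hx. split; [exact (is_derive_const _ _)|].
    split; [exact (is_derive_const _ _)|ring].
Qed.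

(** * Classification *)

(** A connection that is neither flat nor of the normal form has at most three
    independent Killing fields, a flat one at least five. *)
Lemma killing_dim4_normal C : (forall i j k, C i j k = C j i k) ->
  dim_vf (affine_killing (typeB C)) 4 ->
  exists p q kappa, C = Cnormal p q kappa /\ kappa * (p - kappa + 1) <> 0.
Proof.
  intros hsym hdim.
  assert (NF : exists i j, ric C i j <> 0).
  { apply Classical_Prop.NNPP. intros NE.
    assert (5 <= 4)%nat; [|lia]. apply (flat_dim C 4 hsym); auto. intros i j.
    destruct (Req_dec (ric C i j) 0); auto. exfalso. apply NE. now exists i, j. }
  destruct (isotropy_small C hsym NF) as [[w Hw]|[Z1 [Z2 Z3]]].
  - pose proof (isotropy_functional_dim C w 4 hsym Hw hdim). lia.
  - pose proof (Cnormal_eq C hsym Z1 Z2 Z3) as HC.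
    do 3 eexists. split; [exact HC|]. intros Z.
    destruct NF as [i [j NF]]. apply NF. rewrite HC, ric_Cnormal. destruct i, j; auto.
Qed.

Lemma csqrt_4 d : csqrt (4 * d) = (RtoC 2 * csqrt d)%C.
Proof.
  unfold csqrt. destruct (Rle_dec 0 (4 * d)) as [h|h], (Rle_dec 0 d) as [h'|h'];
    try (exfalso; lra).
  - rewrite sqrt_mult by lra. replace 4 with (2 * 2) by ring.
    rewrite sqrt_square by lra. apply RtoC_mult.
  - replace (- (4 * d)) with (4 * - d) by ring. rewrite sqrt_mult by lra.
    replace 4 with (2 * 2) by ring. rewrite sqrt_square, RtoC_mult by lra. ring.
Qed.

Lemma Z1_generic kappa mu : let N := typeB (Z1 kappa) in let r := kappa * (kappa + 1) in
  r <> 0 -> mu <> -1 ->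
  (1 / 4 + r * (1 + mu) <> 0 ->
     spanned_by_powers (E mu N)
       (RtoC (1 / 2 + kappa) + csqrt (1 / 4 + r * (1 + mu)))%C
       (RtoC (1 / 2 + kappa) - csqrt (1 / 4 + r * (1 + mu)))%C) /\
  (1 / 4 + r * (1 + mu) = 0 ->
     mu = - (1 / 4) * (1 + 4 * r) * / r /\
     same_space (E mu N)
       (times_span (fun x1 _ => Rpower x1 (kappa + 1 / 2))
          [fun _ _ => 1; fun x1 _ => ln x1])).
Proof.
  intros N r hr hmu. unfold N. rewrite Z1_Cnormal.
  assert (Er : kappa * (2 * kappa - kappa + 1) = r) by (unfold r; ring).
  split; intros D.
  - apply E_spanned_by_powers; auto; rewrite ?Er; auto; unfold r; field.
  - split.
    + apply (Rmult_eq_reg_r r); auto. field_simplify; auto. lra.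
    + apply E_double_root; auto; rewrite ?Er; auto; [field|].
      rewrite <- D. unfold r. field.
Qed.

Lemma Z2_generic kappa theta mu :
  let N := typeB (Z2 kappa theta) in let r := kappa * (kappa + theta) in
  r <> 0 -> mu <> -1 ->
  ((2 * kappa + theta) ^ 2 + 4 * mu * r <> 0 ->
     spanned_by_powers (E mu N)
       (RtoC (1 / 2) * (RtoC (2 * kappa + theta)
          + csqrt ((2 * kappa + theta) ^ 2 + 4 * mu * r)))%C
       (RtoC (1 / 2) * (RtoC (2 * kappa + theta)
          - csqrt ((2 * kappa + theta) ^ 2 + 4 * mu * r)))%C) /\
  ((2 * kappa + theta) ^ 2 + 4 * mu * r = 0 ->
     mu = - (1 / 4) * (2 * kappa + theta) ^ 2 * / r /\
     same_space (E mu N)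
       (times_span (fun x1 _ => Rpower x1 (kappa + 1 / 2 * theta))
          [fun _ _ => 1; fun x1 _ => ln x1])).
Proof.
  intros N r hr hmu. unfold N. rewrite Z2_Cnormal.
  assert (Er : kappa * (2 * kappa + theta - 1 - kappa + 1) = r) by (unfold r; ring).
  split; intros D.
  - set (s := kappa + 1 / 2 * theta). set (d := s * s + mu * r).
    assert (Ed : (2 * kappa + theta) ^ 2 + 4 * mu * r = 4 * d)
      by (unfold d, s; field).
    rewrite Ed, csqrt_4 in *.
    replace (RtoC (2 * kappa + theta)) with (RtoC (2 * s))
      by (f_equal; unfold s; field).
    assert (Eh : (RtoC (1 / 2) * RtoC 2)%C = RtoC 1)
      by (rewrite <- RtoC_mult; f_equal; field).
    replace (RtoC (1 / 2) * (RtoC (2 * s) + RtoC 2 * csqrt d))%C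
      with (RtoC s + csqrt d)%C.
    2: { rewrite RtoC_mult.
         transitivity ((RtoC (1 / 2) * RtoC 2) * (RtoC s + csqrt d))%C; [|ring].
         rewrite Eh. ring. }
    replace (RtoC (1 / 2) * (RtoC (2 * s) - RtoC 2 * csqrt d))%C
      with (RtoC s - csqrt d)%C.
    2: { rewrite RtoC_mult.
         transitivity ((RtoC (1 / 2) * RtoC 2) * (RtoC s - csqrt d))%C; [|ring].
         rewrite Eh. ring. }
    apply E_spanned_by_powers; auto; rewrite ?Er; auto.
    + unfold s. field.
    + intros Z. apply D. rewrite Z. ring.
  - split.
    + apply (Rmult_eq_reg_r r); auto. field_simplify; auto. lra.
    + apply E_double_root; auto; rewrite ?Er; auto; [field|].
      apply (Rmult_eq_reg_l 4); [|lra]. rewrite Rmult_0_r, <- D. field.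
Qed.

Lemma Z3_generic kappa mu : let N := typeB (Z3 kappa) in let r := kappa ^ 2 in
  r <> 0 -> mu <> -1 ->
  spanned_by_powers (E mu N)
    (RtoC kappa + csqrt (r * (1 + mu)))%C (RtoC kappa - csqrt (r * (1 + mu)))%C.
Proof.
  intros N r hr hmu. unfold N. rewrite Z3_Cnormal.
  assert (Er : kappa * (2 * kappa - 1 - kappa + 1) = r) by (unfold r; ring).
  apply E_spanned_by_powers; auto; rewrite ?Er; auto.
  - ring.
  - unfold r. ring.
  - apply Rmult_integral_contrapositive_currified; auto. lra.
Qed.

Theorem theorem3p8 (C : idx -> idx -> idx -> R)
  (hsym : forall i j k, C i j k = C j i k)
  (hdim : dim_vf (affine_killing (typeB C)) 4) :
  (exists kappa : R,
     let N := typeB (Z1 kappa) in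
     let r := kappa * (kappa + 1) in
     linearly_isomorphic (typeB C) N /\
     r <> 0 /\ ricci_is (typeB C) r /\ ricci_is N r /\
     same_space (E (-1) N)
       (times_span (fun x1 _ => Rpower x1 kappa)
          [fun _ _ => 1; fun x1 _ => x1; fun x1 x2 => x2 + x1 * ln x1]) /\
     forall mu : R, mu <> -1 ->
       (1 / 4 + r * (1 + mu) <> 0 ->
          spanned_by_powers (E mu N)
            (RtoC (1 / 2 + kappa) + csqrt (1 / 4 + r * (1 + mu)))%C
            (RtoC (1 / 2 + kappa) - csqrt (1 / 4 + r * (1 + mu)))%C) /\
       (1 / 4 + r * (1 + mu) = 0 ->
          mu = - (1 / 4) * (1 + 4 * r) * / r /\
          same_space (E mu N)
            (times_span (fun x1 _ => Rpower x1 (kappa + 1 / 2))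
               [fun _ _ => 1; fun x1 _ => ln x1])))
  \/
  (exists kappa theta : R,
     let N := typeB (Z2 kappa theta) in
     let r := kappa * (kappa + theta) in
     theta <> 0 /\
     linearly_isomorphic (typeB C) N /\
     r <> 0 /\ ricci_is (typeB C) r /\ ricci_is N r /\
     same_space (E (-1) N)
       (times_span (fun x1 _ => Rpower x1 kappa)
          [fun _ _ => 1; fun _ x2 => x2; fun x1 _ => Rpower x1 theta]) /\
     forall mu : R, mu <> -1 ->
       ((2 * kappa + theta) ^ 2 + 4 * mu * r <> 0 ->
          spanned_by_powers (E mu N)
            (RtoC (1 / 2) * (RtoC (2 * kappa + theta)
               + csqrt ((2 * kappa + theta) ^ 2 + 4 * mu * r)))%C
            (RtoC (1 / 2) * (RtoC (2 * kappa + theta)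
               - csqrt ((2 * kappa + theta) ^ 2 + 4 * mu * r)))%C) /\
       ((2 * kappa + theta) ^ 2 + 4 * mu * r = 0 ->
          mu = - (1 / 4) * (2 * kappa + theta) ^ 2 * / r /\
          same_space (E mu N)
            (times_span (fun x1 _ => Rpower x1 (kappa + 1 / 2 * theta))
               [fun _ _ => 1; fun x1 _ => ln x1])))
  \/
  (exists kappa : R,
     let N := typeB (Z3 kappa) in
     let r := kappa ^ 2 in
     linearly_isomorphic (typeB C) N /\
     r <> 0 /\ ricci_is (typeB C) r /\ ricci_is N r /\
     same_space (E (-1) N)
       (times_span (fun x1 _ => Rpower x1 kappa)
          [fun _ _ => 1; fun _ x2 => x2; fun x1 _ => ln x1]) /\
     forall mu : R, mu <> -1 ->
       spanned_by_powers (E mu N)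
         (RtoC kappa + csqrt (r * (1 + mu)))%C
         (RtoC kappa - csqrt (r * (1 + mu)))%C).
Proof.
  destruct (killing_dim4_normal C hsym hdim) as [p [q [kappa [-> hr]]]].
  clear hsym hdim.
  assert (Iso : forall a b q' p', b <> 0 -> q' = b * q + a * (p - 2 * kappa) -> p' = p ->
    linearly_isomorphic (typeB (Cnormal p q kappa)) (typeB (Cnormal p' q' kappa))).
  { intros a b q' p' nb -> ->. now apply linearly_isomorphic_Cnormal. }
  destruct (Req_dec p (2 * kappa)) as [Ep|np]; [destruct (Req_dec q 0) as [Eq|nq]|].
  - (* both shears and dilations fix the connection, which is the one of theta = 1 *)
    right; left. exists kappa, 1. cbv zeta.
    assert (nr : kappa * (kappa + 1) <> 0)
      by (intros Z; apply hr; rewrite Ep, <- Z; ring).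
    split; [lra|]. split; [|split; [|split; [|split; [|split]]]]; auto.
    + rewrite Z2_Cnormal. apply (Iso 0 1); lra.
    + apply ricci_is_Cnormal. rewrite Ep. ring.
    + rewrite Z2_Cnormal. apply ricci_is_Cnormal. ring.
    + apply Z2_exceptional. lra.
    + intros mu hmu. now apply Z2_generic.
  - left. exists kappa. cbv zeta.
    assert (nr : kappa * (kappa + 1) <> 0)
      by (intros Z; apply hr; rewrite Ep, <- Z; ring).
    split; [|split; [|split; [|split; [|split]]]]; auto.
    + rewrite Z1_Cnormal.
      apply (Iso 0 (/ q)); [now apply Rinv_neq_0_compat| |lra]. now field.
    + apply ricci_is_Cnormal. rewrite Ep. ring.
    + rewrite Z1_Cnormal. apply ricci_is_Cnormal. ring.
    + apply Z1_exceptional.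
    + intros mu hmu. now apply Z1_generic.
  - (* the shear that removes the coefficient q *)
    assert (Iso' : forall p', p' = p ->
      linearly_isomorphic (typeB (Cnormal p q kappa)) (typeB (Cnormal p' 0 kappa))).
    { intros p' Ep. apply (Iso (- q / (p - 2 * kappa)) 1); [lra| |auto].
      field. lra. }
    destruct (Req_dec (p - 2 * kappa + 1) 0) as [Et|nt].
    + right; right. exists kappa. cbv zeta.
      assert (nr : kappa ^ 2 <> 0).
      { intros Z; apply hr. transitivity (kappa ^ 2); auto.
        replace p with (2 * kappa - 1) by lra. ring. }
      split; [|split; [|split; [|split; [|split]]]]; auto.
      * rewrite Z3_Cnormal. apply Iso'. lra.
      * apply ricci_is_Cnormal. replace p with (2 * kappa - 1) by lra. ring.
      * rewrite Z3_Cnormal. apply ricci_is_Cnormal. ring.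
      * apply Z3_exceptional.
      * intros mu hmu. now apply Z3_generic.
    + right; left. exists kappa, (p - 2 * kappa + 1). cbv zeta.
      assert (nr : kappa * (kappa + (p - 2 * kappa + 1)) <> 0)
        by (intros Z; apply hr; rewrite <- Z; ring).
      split; [auto|]. split; [|split; [|split; [|split; [|split]]]]; auto.
      * rewrite Z2_Cnormal. apply Iso'. ring.
      * apply ricci_is_Cnormal. ring.
      * rewrite Z2_Cnormal. apply ricci_is_Cnormal. ring.
      * now apply Z2_exceptional.
      * intros mu hmu. now apply Z2_generic.
Qed.
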